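(* There is an absolute constant $c>0$ such that the following holds. For each $n\ge 1$ let $M_n$ be an $n\times n$ random matrix whose entries are independent random variables, each taking the values $+1$ and $-1$ with probability $1/2$ each. Then for every $\varepsilon>0$ and every $n$ sufficiently large depending on $\varepsilon$, $$\mathbb{P}\left( |\mathrm{Per}(M_n)| \ge n^{(\frac12-\varepsilon)n}\right) \ge 1-n^{-c}.$$
   Context: For an $n\times n$ matrix $M=(a_{ij})$, the permanent is $\mathrm{Per}(M) := \sum_{\sigma\in S_n}\prod_{i=1}^n a_{i\sigma(i)}$. *)

(* Defs.v *)
From HB Require Export structures.
From mathcomp Require Export all_boot all_order all_algebra perm.
From mathcomp Require Export all_classical all_reals all_analysis.
Set Implicit Arguments.
Unset Strict Implicit.
Unset Printing Implicit Defensive.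
Import Order.TTheory GRing.Theory Num.Theory.

Local Open Scope classical_set_scope.
Local Open Scope ring_scope.

Definition permanent (R : comNzRingType) (n : nat) (A : 'M[R]_n) : R :=
  \sum_(s : 'S_n) \prod_(i < n) A i (s i).

Definition mutually_independent (d : measure_display) (T : measurableType d)
    (R : realType) (P : probability T R) (I : finType)
    (X : I -> {RV P >-> R}) : Prop :=
  forall (J : {set I}) (B : I -> set R),
    (forall i, i \in J -> measurable (B i)) ->
    P (\bigcap_(i in [set` J]) (X i @^-1` B i)) =
    (\prod_(i in J) P (X i @^-1` B i))%E.

Definition random_sign (d : measure_display) (T : measurableType d)
    (R : realType) (P : probability T R) (X : {RV P >-> R}) : Prop :=
  P (X @^-1` [set 1]) = (2^-1)%:E /\ P (X @^-1` [set -1]) = (2^-1)%:E.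

Definition random_mx (d : measure_display) (T : measurableType d)
    (R : realType) (P : probability T R) (n : nat)
    (X : 'I_n -> 'I_n -> {RV P >-> R}) (w : T) : 'M[R]_n :=
  \matrix_(i, j) X i j w.

(* Main.v *)
From HB Require Import structures.
From mathcomp Require Import all_boot all_order all_algebra perm ring lra zify.
Set Implicit Arguments.
Unset Strict Implicit.
Unset Printing Implicit Defensive.
Import Order.TTheory GRing.Theory Num.Theory.
Local Open Scope ring_scope.

(* Read the matrix row by row and let [a B] be the permanent of the minor formed by the
   rows read so far and the columns [B].  A new row of signs [x] replaces [a] by
   [B |-> sum_(j in B) x_j a(B - j)].

   Growth.  The energy [sum_(|B| = k) a(B)^2] is the squared norm of a signed sum of
   vectors, one per column, none of which carries more than a fraction [1 / (n - k)] of
   the total; a Hilbert space version of the Littlewood-Offord inequality (Kleitman) shows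
   that the energy grows by a factor of order [n - k] except with small probability.
   It loses more than a factor [2 n] only with probability exponentially small in
   [n - k].  Hence most rows contribute a factor of order [n] and, a few rows before the
   end, some minor has a permanent of absolute value [L >= n^((1/2 - eps) n)] (call it heavy).

   Spreading.  A heavy minor with a missing column [j] stays heavy after adding [j] and
   a row, with probability at least 1/2, independently for the various [j].  So for a
   fixed set [S] of [7 q] columns, with [q] a small multiple of [log n], and a fixed set
   [D] of [2 q] columns, outside probability [O(2^-q)] there is [Q] in [D] of size [q]
   such that the minor missing exactly [S] and [Q] is heavy.  By Markov and the pigeonhole
   principle a single [Q] serves a proportion [n^-c] of the sets [S].

   Endgame.  For the last [8 q] rows, either [Q] loses an element (with probability at
   least 1/3), or, outside probability [n^-c] by Littlewood-Offord, the sets [S] lose one;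
   the proportion of good [S] decreases at most by a factor 4 at each step.  At the end
   both sets are empty. *)

(** * Small ball estimates for signed sums *)

Section SignedSums.
Variables (R : realFieldType) (I : finType).
Local Notation V := {ffun I -> R}.
Implicit Types (u v w y : V) (vs ws : seq V) (f g : V -> R).

Definition dotf u v : R := \sum_i u i * v i.
Definition normsq u : R := dotf u u.

Lemma dotfDl u v w : dotf (u + v) w = dotf u w + dotf v w.
Proof. by rewrite -big_split; apply: eq_bigr => i _; rewrite ffunE mulrDl. Qed.

Lemma dotfNl u v : dotf (- u) v = - dotf u v.
Proof. by rewrite -sumrN; apply: eq_bigr => i _; rewrite ffunE mulNr. Qed.

Lemma dotfC u v : dotf u v = dotf v u.
Proof. by apply: eq_bigr => i _; rewrite mulrC. Qed.

Lemma normsq_ge0 u : 0 <= normsq u.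
Proof. by apply: sumr_ge0 => i _; rewrite -expr2 sqr_ge0. Qed.

Lemma normsqN u : normsq (- u) = normsq u.
Proof. by rewrite /normsq dotfNl dotfC dotfNl opprK. Qed.

Lemma normsq0 : normsq 0 = 0.
Proof. by rewrite /normsq /dotf big1 // => i _; rewrite ffunE mul0r. Qed.

Lemma normsqD u v : normsq (u + v) = normsq u + normsq v + 2 * dotf u v.
Proof.
rewrite /normsq dotfDl (dotfC u) (dotfC v) !dotfDl (dotfC v u); ring.
Qed.

Lemma normsqB u v : normsq (u - v) = normsq u + normsq v - 2 * dotf u v.
Proof. by rewrite normsqD normsqN dotfC dotfNl dotfC; ring. Qed.

Lemma dotf_sq_le u v : dotf u v ^+ 2 <= normsq u * normsq v.
Proof.
have [v0|v0] := eqVneq (normsq v) 0.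
  suff -> : dotf u v = 0 by rewrite v0 expr0n mulr0.
  apply: big1 => i _.
  have : \sum_(j | true) v j * v j == 0 by rewrite -[X in X == _]/(normsq v) v0.
  rewrite psumr_eq0; last by move=> j _; rewrite -expr2 sqr_ge0.
  by move/allP/(_ i); rewrite mem_index_enum mulf_eq0 orbb => /(_ isT) /eqP ->; rewrite mulr0.
have vp : 0 < normsq v by rewrite lt_neqAle eq_sym v0 normsq_ge0.
pose c := dotf u v / normsq v.
have H : 0 <= \sum_i (u i - c * v i) ^+ 2 by apply: sumr_ge0 => i _; exact: sqr_ge0.
have E : \sum_i (u i - c * v i) ^+ 2 = normsq u - 2 * c * dotf u v + c ^+ 2 * normsq v.
  rewrite /normsq /dotf !mulr_sumr -sumrB -big_split /=.
  by apply: eq_bigr => i _; ring.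
have cv : c * normsq v = dotf u v by rewrite /c divfK.
have := mulr_ge0 H (ltW vp); rewrite E; clearbody c; nra.
Qed.

(* [rsum vs f y] is the mean of [f] at [y] plus a uniformly random signed sum of [vs]. *)
Fixpoint rsum vs f y : R :=
  if vs is v :: vs' then (rsum vs' f (y + v) + rsum vs' f (y - v)) / 2 else f y.

Definition total vs : R := \sum_(v <- vs) normsq v.

Lemma eq_rsum vs f g y : f =1 g -> rsum vs f y = rsum vs g y.
Proof. by move=> fg; elim: vs y => //= v vs IH y; rewrite !IH. Qed.

Lemma ler_rsum vs f g y : (forall z, f z <= g z) -> rsum vs f y <= rsum vs g y.
Proof.
move=> fg; elim: vs y => //= v vs IH y.
have := IH (y + v); have := IH (y - v); lra.
Qed.

Lemma rsum_cst vs c y : rsum vs (fun=> c) y = c.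
Proof. by elim: vs y => //= v vs IH y; rewrite !IH; field. Qed.

Lemma rsum_lin vs c f g y :
  rsum vs (fun z => c * f z + g z) y = c * rsum vs f y + rsum vs g y.
Proof. by elim: vs y => //= v vs IH y; rewrite !IH; field. Qed.

Lemma rsum_sum (T : Type) (r : seq T) vs (F : T -> V -> R) y :
  rsum vs (fun z => \sum_(t <- r) F t z) y = \sum_(t <- r) rsum vs (F t) y.
Proof.
elim: r => [|t r IH].
  by rewrite big_nil -[RHS](rsum_cst vs 0 y); apply: eq_rsum => z; rewrite big_nil.
rewrite big_cons -IH -[rsum vs (F t) y]mul1r -rsum_lin.
by apply: eq_rsum => z; rewrite big_cons mul1r.
Qed.

Lemma rsum_cat vs ws f y : rsum (vs ++ ws) f y = rsum vs (rsum ws f) y.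
Proof. by elim: vs y => //= v vs IH y; rewrite !IH. Qed.

Lemma rsum_shift vs f y u : rsum vs f (y + u) = rsum vs (fun w => f (y + w)) u.
Proof. by elim: vs u => //= v vs IH u; rewrite -!IH !addrA. Qed.

Lemma rsum_trans vs f y : rsum vs f y = rsum vs (fun w => f (y + w)) 0.
Proof. by rewrite -rsum_shift addr0. Qed.

Lemma rsum_opp vs f y : rsum vs f (- y) = rsum vs (fun w => f (- w)) y.
Proof.
by elim: vs y => //= v vs IH y; rewrite -!IH !opprD opprK [X in X / 2]addrC.
Qed.

Lemma rsum_normsq vs y : rsum vs normsq y = normsq y + total vs.
Proof.
rewrite /total; elim: vs y => [|v vs IH] y /=; first by rewrite big_nil addr0.
by rewrite !IH big_cons normsqD normsqB; field.
Qed.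

(* The correction [- 2 |y|^4] is what makes the induction on the list close. *)
Lemma rsum_normsq2_le vs y :
  rsum vs (fun z => normsq z ^+ 2) y
    <= 3 * (normsq y + total vs) ^+ 2 - 2 * normsq y ^+ 2.
Proof.
rewrite /total; elim: vs y => [|v vs IH] y /=; first by rewrite big_nil addr0; lra.
rewrite big_cons; set s := \sum_(_ <- _) _ in IH *.
have h1 := IH (y + v); have h2 := IH (y - v).
rewrite !normsqD normsqN (dotfC y (- v)) dotfNl dotfC in h1 h2.
have hd := dotf_sq_le y v; rewrite dotfC in hd.
have := normsq_ge0 v; move: h1 h2 hd.
set d := dotf v y; set p := normsq y; set q := normsq v => h1 h2 hd q0.
nra.
Qed.

Lemma rsum_paley_zygmund vs :
  9^-1 <= rsum vs (fun z => (total vs / 2 <= normsq z)%R%:R) 0.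
Proof.
set s := total vs.
have s0 : 0 <= s by apply: sumr_ge0 => v _; exact: normsq_ge0.
have [s_eq0|s_neq0] := eqVneq s 0.
  rewrite s_eq0 (_ : rsum _ _ _ = 1); first by lra.
  by rewrite (@eq_rsum vs _ (fun=> 1)) ?rsum_cst // => z; rewrite mul0r normsq_ge0.
have sp : 0 < s by rewrite lt_neqAle eq_sym s_neq0.
(* With the fourth moment at most [3 s^2], the average of [g] below is at least [x - 9/4 x^2] for
   [x = l s]; the maximum [1/9] is reached at [x = 2/9]. *)
pose l := 2 / (9 * s).
have ls : l * s = 2 / 9 by rewrite /l; field.
have l0 : 0 <= l by rewrite divr_ge0 // mulr_ge0 // ltW.
(* [1_{z >= s/2} >= 2 u - u^2] for [u = l (z - s/2)] *)
pose g z := (2 * l + l ^+ 2 * s) * normsq z + (- l ^+ 2 * normsq z ^+ 2 +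
    (- l * s - l ^+ 2 * s ^+ 2 / 4)).
have gz : forall z, g z <= (s / 2 <= normsq z)%R%:R.
  move=> z.
  have -> : g z = 2 * (l * (normsq z - s / 2)) - (l * (normsq z - s / 2)) ^+ 2.
    by rewrite /g; field.
  have h1 := sqr_ge0 (l * (normsq z - s / 2)).
  have h2 := sqr_ge0 (l * (normsq z - s / 2) - 1).
  case: (leP (s / 2) (normsq z)) => h; rewrite ?mulr1n ?mulr0n.
    by move: h2; set u := l * _; rewrite sqrrB1 => h2; lra.
  have : l * (normsq z - s / 2) <= 0 by apply: mulr_ge0_le0; rewrite // subr_le0 ltW.
  lra.
apply: le_trans (ler_rsum vs 0 gz).
rewrite /g rsum_lin rsum_lin rsum_cst rsum_normsq normsq0 add0r -/s.
have h4 := rsum_normsq2_le vs 0; rewrite normsq0 add0r -/s in h4.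
have : l ^+ 2 * rsum vs (fun z => normsq z ^+ 2) 0 <= l ^+ 2 * (3 * s ^+ 2).
  by apply: ler_wpM2l; [exact: sqr_ge0 | lra].
have -> : l ^+ 2 * (3 * s ^+ 2) = 3 * (l * s) ^+ 2 by ring.
move=> h.
have -> : (2 * l + l ^+ 2 * s) * s = 2 * (l * s) + (l * s) ^+ 2 by ring.
have -> : l ^+ 2 * s ^+ 2 = (l * s) ^+ 2 by ring.
have -> : - l * s = - (l * s) by ring.
rewrite ls in h *; lra.
Qed.

(** * Kleitman's small ball bound, for blocks of vectors *)

Section Kleitman.
Variables (rho : R).

Let sep : rel V := fun u w => 4 * rho <= normsq (u - w).
Let near : V -> R := fun z => (normsq z < rho)%R%:R.

Lemma sep_shift w D : pairwise sep [seq u + w | u <- D] = pairwise sep D.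
Proof.
rewrite pairwise_map; apply: eq_pairwise => u v /=.
by rewrite /sep opprD addrACA subrr addr0.
Qed.

(** The parallelogram law gives [|u - v|^2 <= 2 |u|^2 + 2 |v|^2], which is below [4 rho] inside the
    ball. *)
Lemma near_excl u v : sep u v -> near u = 1 -> near v = 0.
Proof.
rewrite /sep /near => huv.
have [hu _|hu /eqP] := ltP (normsq u) rho; last by rewrite eq_sym oner_eq0.
have [hv|//] := ltP (normsq v) rho; exfalso.
have : normsq (u - v) <= 2 * normsq u + 2 * normsq v.
  by have := normsq_ge0 (u + v); rewrite normsqB normsqD; lra.
lra.
Qed.

Lemma sum_near_le1 D z : pairwise sep D -> \sum_(u <- D) near (u + z) <= 1.
Proof.
rewrite -(sep_shift z) -(big_map (fun u => u + z) xpredT near).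
elim: [seq u + z | u <- D] => [|u s IH]; first by rewrite big_nil ler01.
rewrite pairwise_cons big_cons => /andP[/allP hu hs].
have [nu|nu] : near u = 1 \/ near u = 0 by rewrite /near; case: (_ < _); [left|right].
  rewrite big_seq big1 ?nu ?addr0 // => v vs.
  by apply: near_excl nu; apply: hu.
by rewrite nu add0r IH.
Qed.

Lemma max_dotf_split D w : D != [::] ->
  exists D1 u D2, D = D1 ++ u :: D2 /\ all (fun v => dotf v w <= dotf u w) D.
Proof.
elim: D => // v D IH _; have [->|D0] := eqVneq D [::].
  by exists [::], v, [::]; rewrite /= lexx.
have [D1 [u [D2 [DE /allP hu]]]] := IH D0.
have [h|h] := leP (dotf v w) (dotf u w).
  exists (v :: D1), u, D2; rewrite DE; split=> //=; rewrite h /= -DE.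
  by apply/allP.
exists [::], v, D; split=> //=; rewrite lexx /=.
by apply/allP => z /hu hz; apply: le_trans (ltW h).
Qed.

(* Kleitman's regrouping: the [2q] points [u +- w] are rearranged in two separated
   families of sizes [q + 1] and [q - 1]. *)
Lemma kleitman_regroup D w (F : V -> R) : D != [::] -> rho <= normsq w ->
  pairwise sep D -> exists D1 D2, [/\ pairwise sep D1, pairwise sep D2,
    size D1 = (size D).+1, (size D2).+1 = size D &
    \sum_(u <- D) (F (u + w) + F (u - w)) = \sum_(u <- D1) F u + \sum_(u <- D2) F u].
Proof.
move=> D0 hw hD; have [A [u [B [DE /allP hu]]]] := max_dotf_split w D0.
(* As [u] is maximal in the direction [w], the inner product of [u - v] and [w] is nonnegative, so
   [(u + w) - (v - w) = (u - v) + 2 w] has squared norm at least [4 rho]. Hence [u + w] may join the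
   family [D - w]. *)
exists (u + w :: [seq v - w | v <- D]), [seq v + w | v <- A ++ B]; split.
- rewrite pairwise_cons sep_shift hD andbT; apply/allP => z /mapP[v vD ->].
  rewrite /sep (_ : u + w - (v - w) = (u - v) + (w + w)); last first.
    by apply/ffunP => i; rewrite !ffunE; ring.
  rewrite normsqD (normsqD w w) (dotfC (u - v)) dotfDl !(dotfC w) dotfDl dotfNl.
  rewrite -/(normsq w); have := normsq_ge0 (u - v); have := hu _ vD; lra.
- rewrite sep_shift; apply: subseq_pairwise hD.
  by rewrite DE cat_subseq // subseq_cons.
- by rewrite /= size_map.
- by rewrite size_map DE !size_cat /= addnS.
rewrite big_split /= big_cons !big_map {1}DE !big_cat big_cons /=.
by rewrite DE !big_cat !big_cons /=; ring.
Qed.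

Variables (kap : R) (Q : nat).
Hypotheses (kap_gt0 : 0 < kap) (Q_gt0 : (0 < Q)%N).

(** A scattered block plays the role of one long vector in Kleitman's theorem. *)
Definition scattered vs : bool := kap <= rsum vs (fun w => (rho <= normsq w)%R%:R) 0.

(** Induction on the blocks. When the block sum is long, regrouping replaces a family of size [q] by
    two of sizes [q + 1] and [q - 1], and the mean of [q (Q - q)] over these sizes drops by 1. This
    happens with probability at least [kap], so the bound drops by 1 after division by [kap], which
    pays for one more scattered block since the hitting probabilities sum to at most 1. *)
Lemma kleitman_blocks (bs : seq (seq V)) D : pairwise sep D -> (size D <= Q)%N ->
  (count scattered bs)%:R * \sum_(u <- D) rsum (flatten bs) near u <=
  (count scattered bs)%:R * (size D)%:R / Q%:R
    + (size D)%:R * (Q%:R - (size D)%:R) / kap.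
Proof.
have QR : 0 < Q%:R :> R by rewrite ltr0n.
have sum_le1 vs E : pairwise sep E -> \sum_(u <- E) rsum vs near u <= 1.
  move=> hE; rewrite -(rsum_cst vs 1 0).
  have -> : \sum_(u <- E) rsum vs near u = rsum vs (fun z => \sum_(u <- E) near (u + z)) 0.
    by rewrite rsum_sum; apply: eq_bigr => u _; rewrite rsum_trans.
  by apply: ler_rsum => z; exact: sum_near_le1.
have tail0 E : (size E <= Q)%N -> 0 <= (size E)%:R * (Q%:R - (size E)%:R) / kap.
  by move=> hE; rewrite divr_ge0 ?(ltW kap_gt0) // mulr_ge0 // subr_ge0 ler_nat.
elim: bs D => [|b bs IH] D hD hq.
  by rewrite /= !mul0r add0r tail0.
have [D0|D0] := eqVneq D [::].
  by rewrite D0 big_nil /= !(mulr0, mul0r) add0r.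
set h := count scattered bs in IH.
pose T E := \sum_(u <- E) rsum (flatten bs) near u.
pose bd (q : nat) : R := h%:R * q%:R / Q%:R + q%:R * (Q%:R - q%:R) / kap.
have TE : \sum_(u <- D) rsum (flatten (b :: bs)) near u =
    rsum b (fun w => T [seq u + w | u <- D]) 0.
  rewrite /T; under [RHS]eq_rsum do rewrite big_map.
  by rewrite rsum_sum; apply: eq_bigr => u _; rewrite /= rsum_cat rsum_trans.
have [hb|hb] := boolP (scattered b); last first.
  rewrite /= (negbTE hb) add0n -/h -/(flatten (b :: bs)) TE.
  rewrite -[X in _ <= X](rsum_cst b _ 0) -[X in X <= _]addr0 -[X in _ + X](rsum_cst b 0 0) -rsum_lin.
  apply: ler_rsum => w; rewrite addr0.
  by have := IH [seq u + w | u <- D]; rewrite sep_shift size_map; apply.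
have cE : count scattered (b :: bs) = h.+1 by rewrite /= hb.
rewrite cE.
have T1 := sum_le1 (flatten (b :: bs)) D hD.
(* A family of size [Q] cannot be enlarged, but there the claim is just total mass at most 1. *)
have [qQ|qQ] := eqVneq (size D) Q.
  rewrite qQ subrr mulr0 mul0r addr0 mulfK ?gt_eqF //.
  by rewrite -[X in _ <= X]mulr1 ler_wpM2l.
have ltqQ : (size D < Q)%N by rewrite ltn_neqAle qQ.
suff key : h%:R * \sum_(u <- D) rsum (flatten (b :: bs)) near u <= bd (size D) - 1.
  move: key; rewrite /bd -natr1 mulrDl mul1r.
  have : 0 <= (size D)%:R / Q%:R :> R by rewrite divr_ge0.
  rewrite (mulrDl h%:R 1) mul1r [(_ + _) / Q%:R]mulrDl => h0 h1; lra.
(* The block sum [w] has a symmetric law, so both [D + w] and [D - w] may be averaged, as regrouping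
   requires. *)
have sym : rsum b (fun w => T [seq u + w | u <- D]) 0 =
    rsum b (fun w => 2^-1 * \sum_(u <- D) (rsum (flatten bs) near (u + w) +
                                     rsum (flatten bs) near (u - w)) + 0) 0.
  rewrite rsum_lin rsum_cst addr0.
  have -> : rsum b (fun w => \sum_(u <- D) (rsum (flatten bs) near (u + w) +
                                     rsum (flatten bs) near (u - w))) 0 =
      1 * rsum b (fun w => T [seq u + w | u <- D]) 0
      + rsum b (fun w => T [seq u - w | u <- D]) 0.
    by rewrite -rsum_lin; apply: eq_rsum => w; rewrite mul1r /T !big_map big_split.
  by rewrite -(rsum_opp b (fun w => T [seq u + w | u <- D])) oppr0; field.
rewrite TE sym -[X in X <= _]addr0 -[X in _ + X](rsum_cst b 0 0) -rsum_lin.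
apply: (@le_trans _ _ (rsum b (fun w => (- kap^-1) * (rho <= normsq w)%R%:R + bd (size D)) 0)); last first.
  rewrite rsum_lin rsum_cst mulNr.
  have : 1 <= kap^-1 * rsum b (fun w => (rho <= normsq w)%R%:R) 0.
    by rewrite mulrC ler_pdivlMr ?mul1r.
  by rewrite addrC lerD2l lerN2.
apply: ler_rsum => w; rewrite !addr0.
have [hw|hw] := leP rho (normsq w) => /=; last first.
  rewrite mulr0 add0r big_split /=.
  have h1 := IH [seq u + w | u <- D]; have h2 := IH [seq u - w | u <- D].
  rewrite !sep_shift !size_map !big_map -/(bd _) in h1 h2.
  have := h1 hD hq; have := h2 hD hq; lra.
have [D1 [D2 [s1 s2 e1 e2 ->]]] := kleitman_regroup (rsum (flatten bs) near) D0 hw hD.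
have h1 := IH D1 s1; have h2 := IH D2 s2.
rewrite e1 in h1; have := h1 ltqQ; have := h2 (leq_trans (leqnSn _) _).
rewrite e2 => /(_ hq); rewrite /bd mulr1.
have -> : (size D2)%:R = (size D)%:R - 1 :> R by rewrite -e2 -natr1 addrK.
rewrite -natr1; move: (h%:R) (\sum_(u <- D1) _) (\sum_(u <- D2) _) => c S1 S2 h2' h1'.
set q : R := (size D)%:R in h1' h2' *.
set k := kap^-1; set e := Q%:R^-1.
rewrite -/k -/e in h1' h2'.
nra.
Qed.

(** The family is the single point 0. The free parameter [Q] would be taken near the square root of
    [kap h] to get the usual rate. *)
Lemma small_ball (bs : seq (seq V)) (h : nat) : (0 < h)%N ->
  (h <= count scattered bs)%N ->
  rsum (flatten bs) near 0 <= Q%:R^-1 + Q%:R / (kap * h%:R).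
Proof.
move=> h0 hc; have := @kleitman_blocks bs [:: 0] isT Q_gt0.
rewrite big_seq1 /= mulr1 mul1r.
set c : R := (count scattered bs)%:R; set X := rsum _ _ _ => H.
have cp : 0 < c by rewrite ltr0n (leq_trans h0).
have hR : 0 < h%:R :> R by rewrite ltr0n.
have hcR : h%:R <= c by rewrite ler_nat.
apply: (@le_trans _ _ (Q%:R^-1 + Q%:R / (kap * c))).
  rewrite -(ler_pM2l cp); apply: le_trans H _.
  rewrite mulrDr lerD2l invfM mulrCA [c * _]mulrC -mulrA mulVf ?gt_eqF // mulr1.
  by rewrite ler_pM2r ?invr_gt0 // lerBlDr lerDl.
rewrite lerD2l ler_wpM2l // lef_pV2 ?posrE ?mulr_gt0 //.
by rewrite ler_wpM2l // ltW.
Qed.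

End Kleitman.

Lemma total_prefix (b t : R) vs : 0 < b -> all (fun v => normsq v <= t) vs ->
  b <= total vs -> exists ws ws', [/\ vs = ws ++ ws', b <= total ws & total ws <= b + t].
Proof.
rewrite /total => b0; elim/last_ind: vs => [|vs v IH].
  by rewrite big_nil => _ /(lt_le_trans b0); rewrite ltxx.
rewrite all_rcons => /andP[hv hvs] hb.
have [h|h] := leP b (\sum_(v <- vs) normsq v).
  have [ws [ws' [E h1 h2]]] := IH hvs h; exists ws, (rcons ws' v).
  by rewrite E rcons_cat.
exists (rcons vs v), [::]; rewrite cats0; split=> //.
by rewrite -cats1 big_cat big_seq1 /= lerD // ltW.
Qed.

(** Greedy cutting: a block is closed once its total reaches [b], hence overshoots by at most one
    vector. *)
Lemma blocks_of_total (b t : R) (M : nat) vs : 0 < b -> 0 <= t ->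
  all (fun v => normsq v <= t) vs -> M%:R * (b + t) <= total vs ->
  exists2 bs, flatten bs = vs & (M <= count (fun ws => (b <= total ws)%R) bs)%N.
Proof.
move=> b0 t0; elim: M vs => [|M IH] vs hvs hM.
  by exists [:: vs]; rewrite //= cats0.
have Mbt : 0 <= M%:R * (b + t) by rewrite mulr_ge0 // addr_ge0 // ltW.
rewrite -natr1 mulrDl mul1r in hM.
have hb : b <= total vs by lra.
have [ws [ws' [E h1 h2]]] := total_prefix b0 hvs hb.
move: hvs hM; rewrite E all_cat /total big_cat /= -!/(total _) => /andP[_ hws'] hM.
have hM' : M%:R * (b + t) <= total ws' by lra.
have [bs <- hbs] := IH ws' hws' hM'.
by exists (ws :: bs); rewrite //= h1.
Qed.
End SignedSums.

(** * Row-by-row exposure *)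

Section RowProcess.
Variables (R : realFieldType) (n : nat).
Local Notation row := {ffun 'I_n -> bool}.
Local Notation state := ({set 'I_n} -> R).
Implicit Types (x : row) (a : state) (A B C D F S Q : {set 'I_n}).

(* If [a B] is the permanent of the minor of the rows read so far on the columns [B],
   then [upd x a] does the same after the row [x] of signs. *)
Definition upd x a : state := fun B => \sum_(j in B) (-1) ^+ (x j) * a (B :\ j).

Definition avg (f : row -> R) : R := (\sum_x f x) / 2 ^+ n.

Fixpoint avgn (m : nat) (f : state -> R) a : R :=
  if m is m'.+1 then avg (fun x => avgn m' f (upd x a)) else f a.

Let pow2_gt0 : 0 < 2 ^+ n :> R. Proof. by rewrite exprn_gt0. Qed.

Lemma eq_avg f g : f =1 g -> avg f = avg g.
Proof. by move=> fg; rewrite /avg (eq_bigr g). Qed.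

Lemma ler_avg f g : (forall x, f x <= g x) -> avg f <= avg g.
Proof. by move=> fg; rewrite ler_pM2r ?invr_gt0 // ler_sum. Qed.

Lemma avg_cst c : avg (fun=> c) = c.
Proof.
rewrite /avg sumr_const card_ffun card_bool card_ord -[c *+ _]mulr_natr natrX mulfK //.
by rewrite gt_eqF.
Qed.

Lemma avg_lin c f g : avg (fun x => c * f x + g x) = c * avg f + avg g.
Proof. by rewrite /avg big_split /= -mulr_sumr mulrDl mulrA. Qed.

Lemma avgZ c f : avg (fun x => c * f x) = c * avg f.
Proof. by rewrite /avg -mulr_sumr mulrA. Qed.

Lemma avg_sum (T : Type) (r : seq T) (P : pred T) (F : T -> row -> R) :
  avg (fun x => \sum_(t <- r | P t) F t x) = \sum_(t <- r | P t) avg (F t).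
Proof. by rewrite /avg exchange_big mulr_suml. Qed.

Lemma eq_avgn m f g a : f =1 g -> avgn m f a = avgn m g a.
Proof. by move=> fg; elim: m a => //= m IH a; apply: eq_avg. Qed.

Lemma ler_avgn m f g a : (forall b, f b <= g b) -> avgn m f a <= avgn m g a.
Proof. by move=> fg; elim: m a => //= m IH a; apply: ler_avg. Qed.

Lemma avgn_cst m c a : avgn m (fun=> c) a = c.
Proof. by elim: m a => //= m IH a; rewrite -[RHS]avg_cst; apply: eq_avg => x; exact: IH. Qed.

Lemma avgn_lin m c f g a :
  avgn m (fun b => c * f b + g b) a = c * avgn m f a + avgn m g a.
Proof. by elim: m a => //= m IH a; rewrite -avg_lin; apply: eq_avg. Qed.

Lemma avgn_sum (T : Type) (r : seq T) (P : pred T) m (F : T -> state -> R) a :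
  avgn m (fun b => \sum_(t <- r | P t) F t b) a = \sum_(t <- r | P t) avgn m (F t) a.
Proof. by elim: m a => //= m IH a; rewrite -avg_sum; apply: eq_avg. Qed.

Lemma avgnD m1 m2 f a : avgn (m1 + m2) f a = avgn m1 (avgn m2 f) a.
Proof. by elim: m1 a => //= m1 IH a; apply: eq_avg. Qed.

Lemma avgn_le1 m (p : state -> bool) a : avgn m (fun b => (p b)%:R) a <= 1.
Proof. by rewrite -[leRHS](avgn_cst m 1 a); apply: ler_avgn => b; case: (p b). Qed.

(** Chains two stages of rows: [p] is the failure of the first, [q] that of the second. *)
Lemma avgn_compose m1 m2 (p q : state -> bool) e a : 0 <= e ->
  (forall b, ~~ p b -> avgn m2 (fun b => (q b)%:R) b <= e) ->
  avgn (m1 + m2) (fun b => (q b)%:R) a <= avgn m1 (fun b => (p b)%:R) a + e.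
Proof.
move=> e0 he; rewrite avgnD -(avgn_cst m1 e a) -[avgn m1 (fun b => (p b)%:R) a]mul1r -avgn_lin.
apply: ler_avgn => b; rewrite mul1r; case: (boolP (p b)) => hb.
  by have := avgn_le1 m2 q b; rewrite mulr1n; lra.
by rewrite add0r he.
Qed.

Definition flip (i : 'I_n) x : row := [ffun k => if k == i then ~~ x k else x k].

Lemma flipK i : involutive (flip i).
Proof. by move=> x; apply/ffunP => k; rewrite !ffunE; case: eqP; rewrite ?negbK. Qed.

Lemma flip_id i x : flip i x i = ~~ x i.
Proof. by rewrite ffunE eqxx. Qed.

Lemma flip_neq i k x : k != i -> flip i x k = x k.
Proof. by rewrite ffunE => /negbTE ->. Qed.

Lemma avg_flip i f : avg f = avg (fun x => (f x + f (flip i x)) / 2).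
Proof.
have -> : avg (fun x => (f x + f (flip i x)) / 2) = (avg f + avg (f \o flip i)) / 2.
  by rewrite /avg -mulr_suml big_split /=; field; rewrite ?gt_eqF.
have <- : avg f = avg (f \o flip i).
  by rewrite /avg (reindex_inj (inv_inj (flipK i))).
by field.
Qed.

Lemma upd_flip_out i x a B : i \notin B -> upd (flip i x) a B = upd x a B.
Proof.
move=> iB; apply: eq_bigr => j jB; rewrite flip_neq //.
by apply: contraNneq iB => <-.
Qed.

Lemma upd_flip_in i x a B : i \in B ->
  upd (flip i x) a B = upd x a B - 2 * ((-1) ^+ (x i) * a (B :\ i)).
Proof.
move=> iB; rewrite /upd (bigD1 i) //= [in RHS](bigD1 i) //= flip_id.
rewrite (eq_bigr (fun j => (-1) ^+ (x j) * a (B :\ j))) => [|j /andP[_ ji]].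
  by case: (x i); rewrite /= ?expr0 ?expr1; ring.
by rewrite flip_neq.
Qed.

(** Flipping the sign in column [j] moves the permanent on [j |: A] by [2 |a A| >= 2 L], so at most
    one of the two signs leaves it below [L]. The flip does not affect [k |: A] for the other [k] in
    [F], so the factors 1/2 multiply. *)
Lemma escape A F a (L : R) : [disjoint A & F] -> L <= `|a A| ->
  avg (fun x => [forall j in F, `|upd x a (j |: A)| < L]%R%:R) <= 2^-1 ^+ #|F|.
Proof.
move=> dAF hA.
suff key (s : seq 'I_n) : uniq s -> {subset s <= F} ->
    avg (fun x => (all (fun j => `|upd x a (j |: A)| < L) s)%:R) <= 2^-1 ^+ size s.
  have sF : {subset enum F <= F} by move=> j; rewrite mem_enum.
  rewrite cardE; apply: le_trans (key _ (enum_uniq _) sF).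
  apply: ler_avg => x; rewrite ler_nat; case: forall_inP => // h.
  by rewrite (_ : all _ _) //; apply/allP => j; rewrite mem_enum => /h.
elim: s => [_ _|j s IH].
  by rewrite (@eq_avg _ (fun=> 1)) ?avg_cst.
move=> /= /andP[js us] sF.
have jF : j \in F by apply: sF; rewrite inE eqxx.
have jA : j \notin A by move: dAF; rewrite disjoint_sym => /disjointFr ->.
have {}IH := IH us (fun k ks => sF k (mem_behead (s := j :: s) ks)).
rewrite (avg_flip j) exprS; apply: (@le_trans _ _ (2^-1 * avg (fun x =>
    (all (fun j => `|upd x a (j |: A)| < L) s)%:R))); last by rewrite ler_pM2l ?invr_gt0.
rewrite -avgZ; apply: ler_avg => x.
rewrite [X in _ && X](_ : _ = all (fun j => `|upd x a (j |: A)| < L) s) => [|]; last by [].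
have -> : all (fun j0 => `|upd (flip j x) a (j0 |: A)| < L) s =
          all (fun j => `|upd x a (j |: A)| < L) s.
  apply: eq_in_all => k ks; rewrite upd_flip_out // !inE negb_or jA andbT.
  by apply: contraNneq js => ->.
case: (all _ s); rewrite ?andbF ?andbT ?addr0 ?mul0r ?mulr0 //.
rewrite upd_flip_in ?setU11 // setU1K // mulrC ler_pM2l ?invr_gt0 //.
case: (ltP `|upd x a (j |: A)| L) => h1; last by rewrite add0r ler_nat leq_b1.
rewrite (_ : (_ < L) = false) ?addr0 //; apply: le_gtF.
set z := _ * a A; have hz : `|z| = `|a A| by rewrite normrM normrX normrN1 expr1n mul1r.
have := ler_normB (upd x a (j |: A)) (upd x a (j |: A) - 2 * z).
rewrite (_ : upd x a _ - (_ - _) = 2 * z); last by ring.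
rewrite normrM hz (ger0_norm (_ : 0 <= 2)) //; lra.
Qed.

Lemma avg_signed_sum (I : finType) (v : 'I_n -> {ffun I -> R}) f :
  avg (fun x => f (\sum_i (if x i then - v i else v i))) =
  rsum [seq v i | i <- enum 'I_n] f 0.
Proof.
have key (s : seq 'I_n) y : uniq s ->
    avg (fun x => f (y + \sum_(i <- s) (if x i then - v i else v i))) =
    rsum [seq v i | i <- s] f y.
  elim: s y => [|i s IH] y /=.
    by rewrite -[RHS]avg_cst => _; apply: eq_avg => x; rewrite big_nil addr0.
  move=> /andP[js us]; rewrite (avg_flip i) -!IH //.
  rewrite -[X in X + _]mul1r -avg_lin mulrC -avgZ; apply: eq_avg => x.
  rewrite !big_cons flip_id [(_ + _) / 2]mulrC mul1r.
  have -> : \sum_(j <- s) (if flip i x j then - v j else v j) =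
            \sum_(j <- s) (if x j then - v j else v j).
    apply: eq_big_seq => k ks; rewrite flip_neq //.
    by apply: contraNneq js => <-.
  by congr (_ * _); case: (x i); rewrite /= !addrA // [LHS]addrC.
rewrite -key ?enum_uniq //; apply: eq_avg => x; congr f.
by rewrite add0r enumT.
Qed.

End RowProcess.

(** * Growth of the energy *)

Section Energy.
Variables (R : realFieldType) (n : nat).
Local Notation row := {ffun 'I_n -> bool}.
Local Notation state := ({set 'I_n} -> R).
Implicit Types (x : row) (a : state) (A B C D F S : {set 'I_n}).

(** Double counting of the pairs [(B, i)] through [B = i |: A]. *)
Lemma sum_remove_add C k (G : {set 'I_n} -> 'I_n -> R) :
  \sum_(B : {set 'I_n} | (B \subset C) && (#|B| == k.+1)) \sum_(i in B) G (B :\ i) i =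
  \sum_(A : {set 'I_n} | (A \subset C) && (#|A| == k)) \sum_(i in C :\: A) G A i.
Proof.
rewrite !pair_big_dep /=.
rewrite (reindex_onto (fun p : {set 'I_n} * 'I_n => (p.2 |: p.1, p.2))
                      (fun p => (p.1 :\ p.2, p.2))) /=; last first.
  by move=> [B i] /= /andP[_ iB]; rewrite setD1K.
apply: eq_big => [[A i]|[A i] /andP[_ /eqP[->]] //] /=.
rewrite xpair_eqE eqxx andbT setU11 andbT subUset sub1set !inE.
have [iA|iA] := boolP (i \in A).
  rewrite /= [RHS]andbF; apply/negbTE/negP => /andP[_ /eqP E].
  by move: iA; rewrite -E !inE eqxx.
by rewrite setU1K // eqxx andbT cardsU1 iA add1n eqSS /= -andbA andbC.
Qed.

Definition energy C k a : R :=
  \sum_(B : {set 'I_n} | (B \subset C) && (#|B| == k)) a B ^+ 2.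

Lemma energy_ge0 C k a : 0 <= energy C k a.
Proof. by apply: sumr_ge0 => B _; exact: sqr_ge0. Qed.

(* [upd x a] is a signed sum of vectors indexed by the columns, and the vector of a
   column has squared norm at most [energy C k a], which is [(#|C| - k)^-1] times the
   total; so the small ball estimate applies. *)
Lemma energy_growth C k a (M Q : nat) : (0 < M)%N -> (0 < Q)%N -> (k + 2 * M <= #|C|)%N ->
  avg (fun x => (energy C k.+1 (upd x a) <
                 (#|C| - k)%:R * energy C k a / (4 * M%:R))%R%:R)
    <= Q%:R^-1 + 9 * Q%:R / M%:R :> R.
Proof.
move=> M0 Q0 hk; set t := (#|C| - k)%N; set Phi := energy C k a.
have MR : 0 < M%:R :> R by rewrite ltr0n.
have QR : 0 < Q%:R :> R by rewrite ltr0n.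
have tM : 2 * M%:R <= t%:R :> R by rewrite -natrM ler_nat /t; lia.
have [Phi0|PhiN0] := eqVneq Phi 0.
  rewrite (@eq_avg _ _ _ (fun=> 0)) ?avg_cst ?addr_ge0 ?mulr_ge0 ?invr_ge0 // => x.
  by rewrite Phi0 mulr0 mul0r ltNge energy_ge0.
have Phip : 0 < Phi by rewrite lt_neqAle eq_sym PhiN0 energy_ge0.
pose P B := (B \subset C) && (#|B| == k.+1).
pose v (i : 'I_n) : {ffun {set 'I_n} -> R} :=
  [ffun B : {set 'I_n} => if P B && (i \in B) then a (B :\ i) else 0].
have normv i : normsq (v i) = \sum_(B | P B && (i \in B)) a (B :\ i) ^+ 2.
  rewrite [RHS]big_mkcond; apply: eq_bigr => B _; rewrite ffunE.
  by case: ifP; rewrite ?mulr0.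
have v_le i : normsq (v i) <= Phi.
  rewrite normv (reindex_onto (fun A => i |: A) (fun B => B :\ i)) /=; last first.
    by move=> B /andP[_ iB]; rewrite setD1K.
  rewrite /Phi /energy [leRHS]big_mkcond [leLHS]big_mkcond /=; apply: ler_sum => A _.
  case: ifP => [/andP[/andP[/andP[h1 h2] _] /eqP E]|_]; last by case: ifP => // _; exact: sqr_ge0.
  have iA : i \notin A by rewrite -E !inE eqxx.
  move: h1 h2; rewrite subUset sub1set cardsU1 iA add1n eqSS => /andP[_ ->] ->.
  by rewrite setU1K.
have tot : total [seq v i | i <- enum 'I_n] = t%:R * Phi.
  rewrite /total big_map big_enum /=; under eq_bigr do rewrite normv.
  under eq_bigr do rewrite big_mkcondr.
  rewrite exchange_big /=; under eq_bigr do rewrite -big_mkcond.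
  rewrite (sum_remove_add _ _ (fun A _ => a A ^+ 2)) /Phi /energy mulr_sumr.
  apply: eq_bigr => A /andP[AC /eqP kA]; rewrite sumr_const cardsD.
  by rewrite (setIidPr AC) kA mulr_natl.
have sumv x : normsq (\sum_i (if x i then - v i else v i)) = energy C k.+1 (upd x a).
  rewrite /energy [RHS]big_mkcond; apply: eq_bigr => B _; rewrite sum_ffunE -expr2.
  rewrite -/(P B) (eq_bigr (fun i => (if i \in B then
      (if P B then (-1) ^+ (x i) * a (B :\ i) else 0) else 0))) => [|i _].
    rewrite -big_mkcond /=; case: (P B); first by [].
    by rewrite big1 ?expr0n.
  case: (x i); rewrite ?ffunE; case: (P B) => /=; case: (i \in B);
    by rewrite ?oppr0 ?expr1 ?expr0 ?mulN1r ?mul1r.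
(* [M] blocks of total at least [b], each overshooting by at most [Phi], fit in the total [t Phi]
   because [2 M <= t]. *)
pose b : R := t%:R * Phi / (2 * M%:R).
have b0 : 0 < b by rewrite /b divr_gt0 ?mulr_gt0 //; lra.
have [bs Ebs hbs] : exists2 bs, flatten bs = [seq v i | i <- enum 'I_n] &
    (M <= count (fun ws => (b <= total ws)%R) bs)%N.
  apply: (blocks_of_total b0 (ltW Phip)).
    by apply/allP => w /mapP[i _ ->].
  rewrite tot mulrDr (_ : M%:R * b = t%:R * Phi / 2); last by rewrite /b; field; rewrite gt_eqF.
  have := ler_wpM2r (ltW Phip) tM; lra.
have rhoE : t%:R * Phi / (4 * M%:R) = b / 2 by rewrite /b; field; rewrite gt_eqF.
rewrite rhoE; have kap0 : 0 < 9^-1 :> R by rewrite invr_gt0.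
have hc : (M <= count (scattered (b / 2) 9^-1) bs)%N.
  apply: leq_trans hbs _; apply: sub_count => ws hws; rewrite /scattered.
  apply: le_trans (rsum_paley_zygmund ws) _; apply: ler_rsum => z.
  rewrite ler_nat; case: leP => // h1; rewrite (_ : (b / 2 <= normsq z)) //.
  by apply: le_trans h1; rewrite ler_pM2r ?invr_gt0.
have := small_ball kap0 Q0 M0 hc; rewrite Ebs -avg_signed_sum.
rewrite (_ : Q%:R / (9^-1 * M%:R) = 9 * Q%:R / M%:R); last by field; rewrite gt_eqF.
by apply: le_trans; apply: ler_avg => x; rewrite sumv.
Qed.

(** By [escape] and Markov, with the stated probability at least half of the energy sits on sets [A]
    having an extension that is at least as large. Each [B] extends only [k + 1 <= n] sets [A],
    which costs the factor [n]. *)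
Lemma energy_no_drop C k a : (0 < n)%N -> (k < #|C|)%N ->
  avg (fun x => (2 * n%:R * energy C k.+1 (upd x a) < energy C k a)%R%:R)
    <= 2 * 2^-1 ^+ (#|C| - k) :> R.
Proof.
move=> n0 kC; set t := (#|C| - k)%N; set Phi := energy C k a.
have [Phi0|PhiN0] := eqVneq Phi 0.
  rewrite (@eq_avg _ _ _ (fun=> 0)) ?avg_cst ?mulr_ge0 ?exprn_ge0 ?invr_ge0 // => x.
  by rewrite Phi0 ltNge !mulr_ge0 ?energy_ge0.
have Phip : 0 < Phi by rewrite lt_neqAle eq_sym PhiN0 energy_ge0.
pose bad A x := [forall j in C :\: A, `|upd x a (j |: A)| < `|a A| ]%R.
pose Z x : R := \sum_(A : {set 'I_n} | (A \subset C) && (#|A| == k)) a A ^+ 2 * (bad A x)%:R.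
have EZ : avg Z <= 2^-1 ^+ t * Phi.
  rewrite /Z avg_sum mulr_sumr; apply: ler_sum => A /andP[AC /eqP kA].
  rewrite avgZ mulrC; apply: ler_wpM2r; first exact: sqr_ge0.
  have -> : t = #|C :\: A| by rewrite cardsD (setIidPr AC) kA.
  apply: escape => //; rewrite disjoint_sym disjoints_subset.
  by apply/subsetP => i; rewrite !inE => /andP[].
suff H x : (2 * n%:R * energy C k.+1 (upd x a) < Phi)%R%:R <= (2 / Phi) * Z x.
  apply: le_trans (ler_avg H) _; rewrite avgZ.
  rewrite (_ : 2 * 2^-1 ^+ t = (2 / Phi) * (2^-1 ^+ t * Phi)); last by field.
  by rewrite ler_wpM2l // divr_ge0 // ltW.
have Z0 : 0 <= Z x by apply: sumr_ge0 => A _; rewrite mulr_ge0 ?sqr_ge0.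
case: ltP => // h; last by rewrite mulr_ge0 // divr_ge0 // ltW.
have : Phi - Z x <= n%:R * energy C k.+1 (upd x a).
  apply: (@le_trans _ _ (k.+1%:R * energy C k.+1 (upd x a))); last first.
    apply: ler_wpM2r; rewrite ?energy_ge0 // ler_nat (leq_trans kC) //.
    by rewrite -[X in (_ <= X)%N]card_ord max_card.
  have -> : k.+1%:R * energy C k.+1 (upd x a) =
    \sum_(A : {set 'I_n} | (A \subset C) && (#|A| == k))
      \sum_(i in C :\: A) upd x a (i |: A) ^+ 2.
    rewrite -(sum_remove_add C k (fun A i => upd x a (i |: A) ^+ 2)) mulr_sumr.
    apply: eq_bigr => B /andP[_ /eqP kB].
    rewrite (eq_bigr (fun=> upd x a B ^+ 2)) => [|i iB]; last by rewrite setD1K.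
    by rewrite sumr_const kB mulr_natl.
  rewrite /Z /Phi /energy -sumrB; apply: ler_sum => A /andP[AC /eqP kA].
  have s0 : 0 <= \sum_(i in C :\: A) upd x a (i |: A) ^+ 2.
    by apply: sumr_ge0 => i _; exact: sqr_ge0.
  rewrite /bad; case: forall_inP => hb; first by rewrite mulr1 subrr.
  rewrite mulr0 subr0.
  have /existsP[j /andP[jC hj]] : [exists j, (j \in C :\: A) && (`|a A| <= `|upd x a (j |: A)|)].
    apply: contra_notT hb; rewrite negb_exists => /forallP hb j jC.
    by have := hb j; rewrite jC /= -ltNge.
  rewrite (bigD1 j) //= -[leLHS]addr0 lerD //; last by apply: sumr_ge0 => i _; exact: sqr_ge0.
  by rewrite -(real_normK (num_real (a A))) -(real_normK (num_real (upd x a _))) lerXn2r ?nnegrE.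
move=> h1; rewrite mulr1n mulrAC ler_pdivlMr // mul1r; lra.
Qed.

(** * Energy after many rows *)

Section Iterate.
Variables (C : {set 'I_n}) (t M Q : nat) (G p lam : R).
Hypotheses (n_gt0 : (0 < n)%N) (M_gt0 : (0 < M)%N) (Q_gt0 : (0 < Q)%N).
Hypotheses (tM : (2 * M <= t)%N) (G_gt0 : 0 < G) (GM : G * (4 * M%:R) <= t%:R).
Hypothesis (pE : Q%:R^-1 + 9 * Q%:R / M%:R <= p).

Let nR : 0 < 2 * n%:R :> R. Proof. by rewrite mulr_gt0 // ltr0n. Qed.

(** The sum of the drop probabilities [2 * 2^-(i + t)] for [i] from 1 to [m]. *)
Let loss (m : nat) : R := 2 * (2^-1 ^+ t - 2^-1 ^+ (m + t)).

Let loss_ge0 m : 0 <= loss m.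
Proof.
rewrite mulr_ge0 // subr_ge0 ler_wiXn2l ?invr_ge0 ?leq_addl //.
by rewrite invf_le1 // ler1n.
Qed.

Let lossS m : loss m.+1 = loss m + 2 * 2^-1 ^+ (m.+1 + t).
Proof. by rewrite /loss addSn exprS; field. Qed.

(** The energy can afford a loss of [2 n] at every remaining row, so only a drop excluded by
    [energy_no_drop] can hurt. *)
Lemma energy_all_bad m k a : (k + m + t)%N = #|C| ->
  lam * (2 * n%:R) ^+ m <= energy C k a ->
  avgn m (fun b => (energy C (k + m)%N b < lam)%R%:R) a <= loss m.
Proof.
elim: m k a => [|m IH] k a hk hlam /=.
  by rewrite addn0 /loss subrr mulr0; case: ltP => // h; move: hlam; rewrite mulr1; lra.
have kC : (k < #|C|)%N by rewrite -hk; lia.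
rewrite lossS -[loss m](avg_cst n) -[X in _ <= _ + X]mul1r addrC.
have -> : (m.+1 + t)%N = (#|C| - k)%N by lia.
have nd := energy_no_drop a n_gt0 kC.
apply: (@le_trans _ _ (1 * avg (fun x => (2 * n%:R * energy C k.+1 (upd x a) < energy C k a)%R%:R)
    + avg (fun _ : row => loss m))); last by rewrite lerD2r ler_wpM2l.
rewrite -avg_lin; apply: ler_avg => x; rewrite mul1r -addSnnS.
case: ltP => h; last first.
  rewrite add0r; apply: IH; first by lia.
  by rewrite -(ler_pM2l nR); apply: le_trans h; rewrite mulrCA -exprS.
apply: le_trans (avgn_le1 m (fun b => energy C (k.+1 + m)%N b < lam) (upd x a)) _.
by rewrite mulr1n lerDl loss_ge0.
Qed.

(** A row that fails to gain the factor [G] is bad, with conditional probability at most [p]. The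
    target survives [j] bad rows, so barring drops failure needs [j + 1] of them, in one of at most
    [2 ^ m] placements. *)
Lemma energy_iterate m g j k a : (m = g + j)%N -> (k + m + t)%N = #|C| ->
  lam * (2 * n%:R) ^+ j <= energy C k a * G ^+ g ->
  avgn m (fun b => (energy C (k + m)%N b < lam)%R%:R) a
    <= 2 ^+ m * p ^+ j.+1 + loss m.
Proof.
have p0 : 0 <= p.
  by apply: le_trans pE; rewrite addr_ge0 ?divr_ge0 ?mulr_ge0 ?invr_ge0.
have main0 m' j' : 0 <= 2 ^+ m' * p ^+ j' :> R by rewrite mulr_ge0 // exprn_ge0.
elim: m g j k a => [|m IH] [|g] j k a mE hk hlam //.
- rewrite add0n in mE; subst j; rewrite [energy _ _ _ * _]mulr1 in hlam.
  by apply: le_trans (energy_all_bad hk hlam) _; rewrite lerDr.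
- rewrite add0n in mE; subst j; rewrite [energy _ _ _ * _]mulr1 in hlam.
  by apply: le_trans (energy_all_bad hk hlam) _; rewrite lerDr.
have mE' : m = (g + j)%N by lia.
have hk' : (k.+1 + m + t)%N = #|C| by lia.
have kC : (k < #|C|)%N by rewrite -hk; lia.
have kM : (k + 2 * M <= #|C|)%N by lia.
have tk : (t <= #|C| - k)%N by lia.
pose b1 x := (energy C k.+1 (upd x a) <
                 (#|C| - k)%:R * energy C k a / (4 * M%:R))%R.
pose b2 x := (2 * n%:R * energy C k.+1 (upd x a) < energy C k a)%R.
have P1 : avg (fun x => (b1 x)%:R) <= p by apply: le_trans (energy_growth a M_gt0 Q_gt0 kM) pE.
have P2 : avg (fun x => (b2 x)%:R) <= 2 * 2^-1 ^+ (m.+1 + t) :> R.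
  have -> : (m.+1 + t)%N = (#|C| - k)%N by lia.
  exact: energy_no_drop.
have key x : avgn m (fun b => (energy C (k + m.+1)%N b < lam)%R%:R) (upd x a) <=
    (2 ^+ m * p ^+ j) * (b1 x)%:R + (1 * (b2 x)%:R + (2 ^+ m * p ^+ j.+1 + loss m)).
  rewrite mul1r -addSnnS.
  have ml := main0 m j; have ml1 := main0 m j.+1; have l0 := loss_ge0 m.
  have le1 := avgn_le1 m (fun b => energy C (k.+1 + m)%N b < lam) (upd x a).
  rewrite /b2; case: ltP => h2; first by rewrite mulr1n; have := mulr_ge0 ml (ler0n R (b1 x)); lra.
  rewrite add0r /b1; case: ltP => h1; last first.
    rewrite mulr0 add0r; apply: (IH g j _ _ mE' hk').
    apply: le_trans hlam _; rewrite exprS mulrA; apply: ler_wpM2r.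
      by rewrite exprn_ge0 // ltW.
    apply: le_trans h1; rewrite mulrAC mulrC ler_wpM2r ?energy_ge0 //.
    rewrite ler_pdivlMr ?mulr_gt0 ?ltr0n //; apply: le_trans GM _.
    by rewrite ler_nat.
  (* A bad row uses one unit of the budget [j]; when none is left, the bound [2 ^ m * p ^ 0] is at
     least 1. *)
  rewrite mulr1n mulr1; case: j mE mE' hlam ml ml1 {IH} (IH g.+1) => [|j] mE mE' hlam ml ml1 {}IH.
    have : 1 <= 2 ^+ m * p ^+ 0 :> R by rewrite expr0 mulr1 exprn_ege1 // ler1n.
    lra.
  apply: (@le_trans _ _ (2 ^+ m * p ^+ j.+1 + loss m)); last by lra.
  have mE2 : m = (g.+1 + j)%N by rewrite mE' addSnnS.
  apply: (IH _ _ _ mE2 hk').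
  rewrite -(ler_pM2l nR) mulrCA -exprS; apply: le_trans hlam _.
  by rewrite mulrA; apply: ler_wpM2r h2; rewrite exprn_ge0 // ltW.
rewrite /=; apply: le_trans (ler_avg key) _; rewrite avg_lin avg_lin avg_cst lossS (exprS 2 m) (exprS p j).
have := ler_wpM2l (main0 m j) P1; lra.
Qed.

End Iterate.

End Energy.

(** * Absorbing missing columns *)

Section Absorption.
Variables (R : realFieldType) (n : nat).
Local Notation row := {ffun 'I_n -> bool}.
Local Notation state := ({set 'I_n} -> R).
Implicit Types (x : row) (a b : state) (A B C D F S Q : {set 'I_n}).

Definition heavy_missing C D q (L : R) b : bool :=
  [exists Q : {set 'I_n}, [&& Q \subset D, #|Q| == q & (L <= `|b ((C :|: D) :\: Q)|)%R]].

(* Each new row absorbs a missing column of [C] when possible, and otherwise one of [D].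
   The bound comes from the exact solution of the recursion in [(tau, e)]. *)
Lemma absorb C D q (L : R) m tau e A a : [disjoint C & D] -> A \subset C :|: D ->
  #|C :\: A| = tau -> #|D :\: A| = e -> (m + q = tau + e)%N -> (q <= e)%N ->
  L <= `|a A| ->
  avgn m (fun b => (~~ heavy_missing C D q L b)%:R) a <=
    2 * (1 - 2^-1 ^+ tau) * 2^-1 ^+ (e - q) + (2^-1 ^+ q - 2^-1 ^+ (tau + e)).
Proof.
move=> dCD; have half_le1 k : 2^-1 ^+ k <= 1 :> R.
  by rewrite exprn_ile1 ?invr_ge0 // invf_le1 // ler1n.
have half_ge0 k : 0 <= 2^-1 ^+ k :> R by rewrite exprn_ge0 ?invr_ge0.
have twice k : 2 * 2^-1 ^+ k.+1 = 2^-1 ^+ k :> R by rewrite exprS; field.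
have notD j : j \in C -> j \notin D by move=> jC; rewrite (disjointFr dCD).
elim: m tau e A a => [|m IH] tau e A a sA hC hD hm hq hA.
  have [tau0 eq_e] : tau = 0%N /\ e = q by lia.
  rewrite /= tau0 eq_e subnn add0n !subrr mulr0 mul0r addr0.
  rewrite (_ : heavy_missing C D q L a) //; apply/existsP; exists (D :\: A).
  rewrite subsetDl hD eq_e eqxx /=.
  suff -> : (C :|: D) :\: (D :\: A) = A by [].
  apply/setP => i; rewrite !inE; have [iA|iA] := boolP (i \in A) => /=.
    by have := subsetP sA i iA; rewrite inE.
  have := cards0_eq (etrans hC tau0) => /setP /(_ i); rewrite !inE iA /= => ->.
  by case: (i \in D).
(* No column of [D] may be absorbed any more; as [tau > 0], the claimed bound is at least 1. *)
have [eq_e|ne_e] := eqVneq e q.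
  rewrite eq_e subnn expr0 mulr1; apply: le_trans (avgn_le1 _ _ _) _.
  have tau0 : (0 < tau)%N by move: hm; rewrite eq_e; lia.
  have : 2^-1 ^+ tau <= 2^-1 :> R by rewrite -[leRHS]expr1 ler_wiXn2l ?invr_ge0 // invf_le1 // ler1n.
  have : 2^-1 ^+ (tau + q) <= 2^-1 ^+ q :> R.
    by rewrite ler_wiXn2l ?invr_ge0 ?leq_addl // invf_le1 // ler1n.
  lra.
have lt_qe : (q < e)%N by rewrite ltn_neqAle eq_sym ne_e.
pose bad F x := [forall j in F, `|upd x a (j |: A)| < L]%R.
have cardCD : #|(C :|: D) :\: A| = (tau + e)%N.
  rewrite setDUl cardsU hC hD (_ : _ :&: _ = set0) ?cards0 ?subn0 //.
  apply/setP => i; rewrite !inE; have [iC|//] := boolP (i \in C).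
    by rewrite (negbTE (notD _ iC)) !andbF.
  by rewrite !andbF.
have disjA F : [disjoint A & F :\: A].
  rewrite disjoint_sym disjoints_subset.
  by apply/subsetP => i; rewrite !inE => /andP[].
have P1 := escape (disjA C) hA; rewrite hC in P1.
have P2 := escape (disjA (C :|: D)) hA; rewrite cardCD in P2.
(* [X] is the claimed bound at [(tau - 1, e)], and [X + 2 * 2^-(e - q)] is the one at
   [(tau, e - 1)]. *)
pose X : R := 2 * (1 - 2 * 2^-1 ^+ tau) * 2^-1 ^+ (e - q)
              + (2^-1 ^+ q - 2 * 2^-1 ^+ (tau + e)).
have key x : avgn m (fun b => (~~ heavy_missing C D q L b)%:R) (upd x a) <=
    (2 * 2^-1 ^+ (e - q)) * (bad (C :\: A) x)%:R
    + (1 * (bad ((C :|: D) :\: A) x)%:R + X).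
  rewrite mul1r; have [hb1|] := boolP (bad (C :\: A) x); last first.
    rewrite negb_forall_in => /existsP[j /andP[jCA]]; rewrite -leNgt => hj.
    have [jC jA] : j \in C /\ j \notin A by move: jCA; rewrite inE => /andP[].
    have tau0 : (0 < tau)%N by rewrite -hC; apply/card_gt0P; exists j.
    have e1 : #|C :\: (j |: A)| = tau.-1.
      rewrite -hC (cardsD1 j (C :\: A)) jCA add1n /=.
      congr #|pred_of_set _|; apply/setP => i; rewrite !inE.
      by case: (i == j); case: (i \in A).
    have e2 : #|D :\: (j |: A)| = e.
      rewrite -hD; congr #|pred_of_set _|; apply/setP => i; rewrite !inE.
      by case: eqP => //= ->; rewrite (negbTE (notD _ jC)) !andbF.
    have sA' : j |: A \subset C :|: D by rewrite subUset sub1set inE jC sA.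
    have hm' : (m + q = tau.-1 + e)%N by clear - hm tau0; lia.
    have := IH _ _ _ _ sA' e1 e2 hm' hq hj.
    have E1 : 2 * 2^-1 ^+ tau = 2^-1 ^+ tau.-1 :> R.
      by rewrite -{1}(prednK tau0) twice.
    have E2 : 2 * 2^-1 ^+ (tau + e) = 2^-1 ^+ (tau.-1 + e) :> R.
      by rewrite -{1}(prednK tau0) addSn twice.
    rewrite /X E1 E2; have := ler0n R (bad ((C :|: D) :\: A) x); rewrite mulr0n mulr0.
    lra.
  have [hb2|] := boolP (bad ((C :|: D) :\: A) x).
    apply: le_trans (avgn_le1 _ _ _) _; rewrite mulr1n mulr1 /X.
    have : 0 <= 2 * (1 - 2^-1 ^+ tau) * 2^-1 ^+ (e - q) :> R.
      by rewrite !mulr_ge0 // subr_ge0.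
    have : 2 * 2^-1 ^+ (tau + e) <= 2^-1 ^+ q :> R.
      rewrite (_ : (tau + e)%N = (tau + e).-1.+1); last by clear - lt_qe; lia.
      rewrite twice ler_wiXn2l ?invr_ge0 //; last by clear - lt_qe; lia.
      by rewrite invf_le1 // ler1n.
    have := half_le1 tau; have := half_ge0 (e - q)%N.
    move: (2^-1 ^+ tau) (2^-1 ^+ (e - q)) (2^-1 ^+ q) (2^-1 ^+ (tau + e)) => y z u w.
    nra.
  rewrite negb_forall_in => /existsP[j /andP[jCDA]]; rewrite -leNgt => hj.
  have jA : j \notin A by move: jCDA; rewrite inE => /andP[].
  have jD : j \in D.
    move: jCDA; rewrite !inE => /andP[_ /orP[jC|//]]; exfalso.
    by move/forall_inP: hb1 => /(_ j); rewrite inE jA jC => /(_ isT); rewrite ltNge hj.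
  have jC : j \notin C by apply: contraL jD => /notD.
  have e1 : #|C :\: (j |: A)| = tau.
    rewrite -hC; congr #|pred_of_set _|; apply/setP => i; rewrite !inE.
    by case: eqP => //= ->; rewrite (negbTE jC) !andbF.
  have e2 : #|D :\: (j |: A)| = e.-1.
    have jDA : j \in D :\: A by rewrite inE jA.
    rewrite -hD (cardsD1 j (D :\: A)) jDA add1n /=.
    congr #|pred_of_set _|; apply/setP => i; rewrite !inE.
    by case: (i == j); case: (i \in A).
  have sA' : j |: A \subset C :|: D by rewrite subUset sub1set inE jD orbT sA.
  have hm' : (m + q = tau + e.-1)%N by clear - hm lt_qe; lia.
  have hq' : (q <= e.-1)%N by clear - lt_qe; lia.
  have := IH _ _ _ _ sA' e1 e2 hm' hq' hj.
  have E1 : 2 * 2^-1 ^+ (e - q) = 2^-1 ^+ (e.-1 - q) :> R.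
    by rewrite -[RHS]twice; congr (_ * _ ^+ _); clear - lt_qe; lia.
  have E2 : 2 * 2^-1 ^+ (tau + e) = 2^-1 ^+ (tau + e.-1) :> R.
    by rewrite -[RHS]twice; congr (_ * _ ^+ _); clear - lt_qe; lia.
  rewrite /X E2 -E1 mulr0n mulr1n; lra.
rewrite /=; apply: le_trans (ler_avg key) _; rewrite avg_lin avg_lin avg_cst /X.
have z0 : 0 <= 2 * 2^-1 ^+ (e - q) :> R by rewrite mulr_ge0.
have := ler_wpM2l z0 P1; move: P2; rewrite -!/(bad _ _).
lra.
Qed.

End Absorption.

(** * The last rows *)

Section Density.
Variables (R : realFieldType) (n : nat).
Local Notation row := {ffun 'I_n -> bool}.
Local Notation state := ({set 'I_n} -> R).
Implicit Types (x : row) (a b : state) (A B E F S Q : {set 'I_n}).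

(** The one-dimensional case: each coefficient of size at least [L] is by itself a scattered block,
    with [kap = 1]. *)
Lemma littlewood_offord a B (L : R) (h q : nat) : 0 < L -> (0 < h)%N -> (0 < q)%N ->
  (h <= #|[pred i in B | (L <= `|a (B :\ i)|)%R]|)%N ->
  avg (fun x => (`|upd x a B| < L)%R%:R) <= q%:R^-1 + q%:R / h%:R :> R.
Proof.
move=> L0 h0 q0 hh.
pose v (i : 'I_n) : {ffun unit -> R} := [ffun _ => if i \in B then a (B :\ i) else 0].
have nE (w : {ffun unit -> R}) : normsq w = w tt ^+ 2.
  by rewrite /normsq /dotf (big_pred1 tt) ?expr2 // => -[].
have near_lt (z : R) : (z ^+ 2 < L ^+ 2) = (`|z| < L).
  by rewrite -(real_normK (num_real z)) ltr_pXn2r ?nnegrE ?(ltW L0).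
have hc : (h <= count (scattered (L ^+ 2) 1) [seq [:: v i] | i <- enum 'I_n])%N.
  apply: leq_trans hh _; rewrite count_map enumT cardE /enum_mem size_filter.
  apply: sub_count => i /=; rewrite unfold_in /= => /andP[iB hL].
  have hL2 : L ^+ 2 <= a (B :\ i) ^+ 2 by rewrite leNgt near_lt -leNgt.
  by rewrite /scattered /= add0r sub0r !nE !ffunE iB sqrrN hL2 mulr1n; lra.
have := small_ball (ltr01 : 0 < 1 :> R) q0 h0 hc.
rewrite flatten_map1 mul1r -avg_signed_sum; apply: le_trans; apply: ler_avg => x.
rewrite nE near_lt.
suff -> : (\sum_i (if x i then - v i else v i)) tt = upd x a B by [].
rewrite sum_ffunE /upd [RHS]big_mkcond /=; apply: eq_bigr => i _.
by case: (x i); rewrite !ffunE; case: (i \in B); rewrite ?oppr0 ?expr1 ?expr0 ?mulN1r ?mul1r.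
Qed.

Section Fixed.
Variables (E : {set 'I_n}) (L : R).

Definition nsub (s : nat) : R := \sum_(S : {set 'I_n} | (S \subset E) && (#|S| == s)) 1.

(** The missing columns consist of a fixed part [Q] and a varying part [S]; the ratio to [nsub s] is
    the density of good [S]. *)
Definition heavy_count a s Q : R :=
  \sum_(S : {set 'I_n} | (S \subset E) && (#|S| == s)) (L <= `|a (~: (S :|: Q))|)%R%:R.

Lemma heavy_count_ge0 a s Q : 0 <= heavy_count a s Q.
Proof. by apply: sumr_ge0 => S _; exact: ler0n. Qed.

Lemma sum_children s (G : {set 'I_n} -> R) :
  s.+1%:R * \sum_(S : {set 'I_n} | (S \subset E) && (#|S| == s.+1)) G S =
  \sum_(S : {set 'I_n} | (S \subset E) && (#|S| == s)) \sum_(i in E :\: S) G (i |: S).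
Proof.
rewrite -(sum_remove_add E s (fun S i => G (i |: S))) mulr_sumr.
apply: eq_bigr => S /andP[_ /eqP kS].
rewrite (eq_bigr (fun=> G S)) => [|i iS]; last by rewrite setD1K.
by rewrite sumr_const kS mulr_natl.
Qed.

Lemma nsubS s : s.+1%:R * nsub s.+1 = (#|E| - s)%:R * nsub s.
Proof.
rewrite /nsub sum_children mulr_sumr; apply: eq_bigr => S /andP[SE /eqP kS].
by rewrite sumr_const cardsD (setIidPr SE) kS mulr1.
Qed.

(** By averaging, a proportion [p / 2] of the sets [S] of size [s] is rich: at least [p / 2] of
    their extensions are heavy. For a rich [S] Littlewood-Offord applies with [h] large
    coefficients, and by Markov half of the rich sets survive. *)
Lemma shrink_missing a s Q (p : R) (h q : nat) : 0 < L -> Q \subset ~: E ->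
  (0 < h)%N -> (0 < q)%N -> h%:R <= p / 2 * (#|E| - s)%:R ->
  p * nsub s.+1 <= heavy_count a s.+1 Q ->
  avg (fun x => (heavy_count (upd x a) s Q < p / 4 * nsub s)%R%:R)
    <= 2 * (q%:R^-1 + q%:R / h%:R) :> R.
Proof.
move=> L0 QE h0 q0; set dl : R := (#|E| - s)%:R => hp hcount.
have beta0 : 0 <= q%:R^-1 + q%:R / h%:R :> R by rewrite addr_ge0 ?divr_ge0 ?invr_ge0.
have dl_ge0 : 0 <= dl by rewrite ler0n.
have hR : 1 <= h%:R :> R by rewrite ler1n.
have dl0 : 0 < dl.
  rewrite lt_neqAle dl_ge0 andbT eq_sym; apply/eqP => d0.
  by move: hp; rewrite d0 mulr0; lra.
have p0 : 0 < p.
  rewrite ltNge; apply/negP => p0.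
  have : p / 2 * dl <= 0 by rewrite mulr_le0_ge0 // mulr_le0_ge0 // invr_ge0.
  lra.
pose hv S : R := (L <= `|a (~: (S :|: Q))|)%R%:R.
pose deg S : R := \sum_(i in E :\: S) hv (i |: S).
pose rich S : bool := (p / 2 * dl <= deg S)%R.
pose W : R := \sum_(S : {set 'I_n} | (S \subset E) && (#|S| == s)) (rich S)%:R.
have hW : p / 2 * nsub s <= W.
  rewrite -(ler_pM2r dl0) -[leRHS](addrK (p / 2 * nsub s * dl)) lerBrDr.
  have -> : p / 2 * nsub s * dl + p / 2 * nsub s * dl = p * (dl * nsub s) by field.
  rewrite -nsubS mulrCA; apply: le_trans (ler_wpM2l _ hcount) _ => //.
  rewrite /heavy_count sum_children /W /nsub mulr_suml mulr_sumr mulr_suml -big_split /=.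
  apply: ler_sum => S /andP[SE /eqP kS]; rewrite -/(deg S) mulr1.
  rewrite /rich; case: (leP (p / 2 * dl) (deg S)) => hd; last by rewrite mul0r add0r ltW.
  rewrite mul1r -[leLHS]addr0 lerD //; last by rewrite !mulr_ge0 ?invr_ge0 ?(ltW p0).
  apply: le_trans (ler_sum _ (G := fun=> 1) _) _.
    by move=> i _; rewrite /hv; case: (L <= `|a _|)%R; rewrite ?ler01.
  by rewrite sumr_const cardsD (setIidPr SE) kS.
have lo S : S \subset E -> rich S ->
    avg (fun x => (`|upd x a (~: (S :|: Q))| < L)%R%:R) <= q%:R^-1 + q%:R / h%:R :> R.
  move=> SE hr; apply: littlewood_offord => //.
  rewrite -(ler_nat R); apply: le_trans hp _; apply: le_trans hr _.
  rewrite /deg /hv -[leRHS]mulr1 mulr_natl -sumr_const.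
  rewrite big_mkcond [leRHS]big_mkcond /=; apply: ler_sum => i _.
  rewrite !inE /=.
  case: ifP => [/andP[iS iE]|_]; last by case: ifP.
  have iQ : i \notin Q.
    by apply: contraL iE => /(subsetP QE); rewrite inE.
  rewrite (negbTE iS) (negbTE iQ) /=.
  have -> : ~: (S :|: Q) :\ i = ~: ((i |: S) :|: Q).
    by apply/setP => j; rewrite !inE; case: (j == i); case: (j \in S).
  by case: (L <= `|a _|)%R.
pose Z x : R := \sum_(S : {set 'I_n} | (S \subset E) && (#|S| == s))
   (rich S)%:R * (`|upd x a (~: (S :|: Q))| < L)%R%:R.
have EZ : avg Z <= (q%:R^-1 + q%:R / h%:R) * W.
  rewrite /Z avg_sum mulr_sumr; apply: ler_sum => S /andP[SE _].
  rewrite avgZ; have [hr|_] := boolP (rich S); last by rewrite !mulr0n mul0r mulr0.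
  by rewrite mul1r mulr1 lo.
have [W0|WN0] := leP W 0.
  rewrite (@eq_avg _ _ _ (fun=> 0)) ?avg_cst ?mulr_ge0 // => x.
  rewrite ltNge (_ : _ <= _) //; apply: le_trans (heavy_count_ge0 _ _ _).
  by move: hW; set y := nsub s => hW; lra.
suff H x : (heavy_count (upd x a) s Q < p / 4 * nsub s)%R%:R <= (2 / W) * Z x.
  apply: le_trans (ler_avg H) _; rewrite avgZ.
  rewrite (_ : 2 * (_ + _) = (2 / W) * ((q%:R^-1 + q%:R / h%:R) * W)); last first.
    by rewrite [_ * W]mulrC mulrA divfK ?gt_eqF.
  by rewrite ler_wpM2l // divr_ge0 // ltW.
have Z0 : 0 <= Z x by apply: sumr_ge0 => S _; rewrite mulr_ge0.
case: ltP => hx; last by rewrite mulr_ge0 // divr_ge0 // ltW.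
have : W - Z x <= heavy_count (upd x a) s Q.
  rewrite /W /Z /heavy_count -sumrB; apply: ler_sum => S _.
  by case: (rich S); case: (leP L `|upd x a (~: (S :|: Q))|); rewrite ?mulr1 ?mulr0 ?subr0 ?subrr ?mul0r.
move=> h1; rewrite mulr1n mulrAC ler_pdivlMr // mul1r.
move: hW hx h1; set y := nsub s => hW hx h1; lra.
Qed.

(** By [escape] in the single column [j], each good [S] is lost with probability at most 1/2; by
    Markov, more than 3/4 of them are lost with probability at most [(1/2) / (3/4)]. *)
Lemma drop_fixed a s Q j (p : R) : Q \subset ~: E -> j \in Q -> 0 <= p ->
  p * nsub s <= heavy_count a s Q ->
  avg (fun x => (heavy_count (upd x a) s (Q :\ j) < p / 4 * nsub s)%R%:R) <= 2 / 3 :> R.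
Proof.
move=> QE jQ p0 hcount; set W := heavy_count a s Q in hcount.
pose Z x : R := \sum_(S : {set 'I_n} | (S \subset E) && (#|S| == s))
   (L <= `|a (~: (S :|: Q))|)%R%:R * (`|upd x a (~: (S :|: (Q :\ j)))| < L)%R%:R.
have EZ : avg Z <= 2^-1 * W.
  rewrite /Z avg_sum mulr_sumr; apply: ler_sum => S /andP[SE _].
  rewrite avgZ mulrC; case: (leP L `|a (~: (S :|: Q))|) => hS; last by rewrite !mulr0.
  rewrite !mulr1n !mulr1.
  have dj : [disjoint ~: (S :|: Q) & [set j]].
    by rewrite disjoint_sym disjoints1 !inE jQ orbT.
  have := escape dj hS; rewrite cards1 expr1; apply: le_trans; apply: ler_avg => x.
  rewrite ler_nat; case: ltP => // h; rewrite (_ : [forall _ in _, _]) //.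
  apply/forall_inP => i; rewrite inE => /eqP ->.
  have jS : j \notin S by apply/negP => /(subsetP SE) jE; move: (subsetP QE _ jQ); rewrite inE jE.
  rewrite (_ : j |: _ = ~: (S :|: (Q :\ j))) //.
  apply/setP => k; rewrite !inE !negb_or negb_and negbK.
  by case: eqP => [->|] /=; rewrite ?jS.
have [W0|WN0] := leP W 0.
  rewrite (@eq_avg _ _ _ (fun=> 0)) ?avg_cst ?divr_ge0 // => x.
  rewrite ltNge (_ : _ <= _) //; apply: le_trans (heavy_count_ge0 _ _ _).
  by move: hcount; set y := nsub s => hcount; lra.
suff H x : (heavy_count (upd x a) s (Q :\ j) < p / 4 * nsub s)%R%:R <= (4 / (3 * W)) * Z x.
  apply: le_trans (ler_avg H) _; rewrite avgZ.
  rewrite (_ : 2 / 3 = (4 / (3 * W)) * (2^-1 * W)); last first.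
    by field; rewrite gt_eqF.
  by rewrite ler_wpM2l // divr_ge0 // mulr_ge0 // ltW.
have Z0 : 0 <= Z x by apply: sumr_ge0 => S _; rewrite mulr_ge0.
case: ltP => hx; last by rewrite mulr_ge0 // divr_ge0 // mulr_ge0 // ltW.
have : W - Z x <= heavy_count (upd x a) s (Q :\ j).
  rewrite /W /Z /heavy_count -sumrB; apply: ler_sum => S _.
  case: (leP L `|a (~: (S :|: Q))|) => _;
  by case: (leP L `|upd x a (~: (S :|: (Q :\ j)))|); rewrite ?mulr1 ?mulr0 ?subr0 ?subrr ?mul0r.
move=> h1; rewrite mulr1n mulrAC ler_pdivlMr ?mulr_gt0 // mul1r.
move: hcount hx h1; set y := nsub s => hW hx h1; lra.
Qed.

Variables (s0 h q0 : nat) (p : R).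
Hypotheses (L_gt0 : 0 < L) (p_gt0 : 0 < p) (h_gt0 : (0 < h)%N) (q0_gt0 : (0 < q0)%N).
Hypothesis (h_le : h%:R <= 2 * p * (#|E| - s0)%:R).

Let err : R := 2 * (q0%:R^-1 + q0%:R / h%:R).

Let err_ge0 : 0 <= err.
Proof. by rewrite mulr_ge0 // addr_ge0 ?divr_ge0 ?invr_ge0. Qed.

Let hp_step s m : (s < s0)%N -> h%:R <= p * 4 ^+ m.+1 / 2 * (#|E| - s)%:R.
Proof.
move=> hs; apply: le_trans h_le _; rewrite exprS.
have -> : p * (4 * 4 ^+ m) / 2 * (#|E| - s)%:R = 2 * p * (4 ^+ m * (#|E| - s)%:R) by field.
rewrite ler_wpM2l ?mulr_ge0 ?(ltW p_gt0) //.
by rewrite -[leLHS]mul1r ler_pM // ?exprn_ege1 ?ler1n // ler_nat leq_sub2l // ltnW.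
Qed.

Let pp_step m : p * 4 ^+ m.+1 / 4 = p * 4 ^+ m.
Proof. by rewrite exprS; field. Qed.

(** Once [Q] is empty every row shrinks [S]. At [s = 0] the only candidate is the empty set, so
    positive density means that the full permanent is heavy. *)
Lemma density_shrink s a : (s <= s0)%N ->
  p * 4 ^+ s * nsub s <= heavy_count a s set0 ->
  avgn s (fun b => (`|b [set: 'I_n]| < L)%R%:R) a <= s%:R * err.
Proof.
elim: s a => [|s IH] a hs hc.
  have only S : (S \subset E) && (#|S| == 0%N) = (S == set0).
    rewrite cards_eq0; apply/andP/eqP => [[_ /eqP]//|->].
    by rewrite sub0set eqxx.
  move: hc; rewrite /nsub /heavy_count !(big_pred1 set0) //.
  rewrite setU0 setC0 /= mulr1 expr0 mulr1 mul0r ltNge; case: (leP L `|a [set: 'I_n]|) => hL //.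
  by rewrite leNgt p_gt0.
have Q0E : set0 \subset ~: E by exact: sub0set.
have PA := shrink_missing L_gt0 Q0E h_gt0 q0_gt0 (hp_step s hs) hc.
rewrite pp_step -/err in PA.
rewrite /=; apply: (@le_trans _ _ (avg (fun x =>
    1 * (heavy_count (upd x a) s set0 < p * 4 ^+ s * nsub s)%R%:R + s%:R * err))).
  apply: ler_avg => x; rewrite mul1r; case: ltP => hx.
    by apply: le_trans (avgn_le1 _ _ _) _; rewrite mulr1n lerDl mulr_ge0.
  by rewrite mulr0n add0r; apply: IH => //; exact: ltnW.
by rewrite avg_lin avg_cst mul1r -[s.+1]addn1 natrD mulrDl mul1r addrC lerD2l.
Qed.

(* Each row either removes an element from the fixed part [Q] (probability at least 1/3)
   or shrinks the varying part; [(3/2)^q] is the exponential weight of the resulting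
   biased walk, with contraction ratio [2/3 + 1/3 * (3/2)^-1 = 8/9]. *)
Lemma density_endgame m s q Q a : m = (s + q)%N -> (s <= s0)%N -> #|Q| = q ->
  Q \subset ~: E -> p * 4 ^+ m * nsub s <= heavy_count a s Q ->
  avgn m (fun b => (`|b [set: 'I_n]| < L)%R%:R) a
    <= (3 / 2) ^+ q * (8 / 9) ^+ m + m%:R * err.
Proof.
have main0 i k : 0 <= (3 / 2) ^+ i * (8 / 9) ^+ k :> R.
  by rewrite mulr_ge0 // exprn_ge0 // divr_ge0.
have four0 k : 0 < p * 4 ^+ k by rewrite mulr_gt0 // exprn_gt0.
have zero m' s' Q' a' : m' = (s' + 0)%N -> (s' <= s0)%N -> #|Q'| = 0%N ->
    p * 4 ^+ m' * nsub s' <= heavy_count a' s' Q' ->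
    avgn m' (fun b => (`|b [set: 'I_n]| < L)%R%:R) a'
      <= (3 / 2) ^+ 0 * (8 / 9) ^+ m' + m'%:R * err.
  rewrite addn0 => -> hs /cards0_eq -> hc.
  by apply: le_trans (density_shrink hs hc) _; rewrite lerDr.
elim: m s q Q a => [|m IH] s [|q] Q a mE hs hQ QE hc.
- exact: (zero _ _ _ _ mE hs hQ hc).
- by move: mE; rewrite addnS.
- exact: (zero _ _ _ _ mE hs hQ hc).
(* If [S] is used up before [Q], the bound is at least [(3/2 * 8/9) ^ m.+1 >= 1]. *)
case: s mE hs hc => [|s] mE hs hc.
  rewrite add0n in mE; apply: le_trans (avgn_le1 _ _ _) _.
  rewrite -mE -exprMn; apply: (@le_trans _ _ ((3 / 2 * (8 / 9)) ^+ m.+1 : R)).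
    by apply: exprn_ege1; lra.
  by rewrite lerDl mulr_ge0.
have mE' : m = (s + q.+1)%N by move: mE; rewrite addSn => -[].
have mE2 : m = (s.+1 + q)%N by rewrite mE' addSnnS.
have /card_gt0P[j jQ] : (0 < #|Q|)%N by rewrite hQ.
have hQj : #|Q :\ j| = q by move: hQ; rewrite (cardsD1 j) jQ add1n => -[].
have QjE : Q :\ j \subset ~: E by apply: subset_trans QE; exact: subD1set.
have PA := shrink_missing L_gt0 QE h_gt0 q0_gt0 (hp_step m hs) hc.
rewrite pp_step -/err in PA.
have PB := drop_fixed QE jQ (ltW (four0 m.+1)) hc; rewrite pp_step in PB.
pose u : R := (3 / 2) ^+ q * (8 / 9) ^+ m.
have u0 : 0 <= u by exact: main0.
have merr : 0 <= m%:R * err by rewrite mulr_ge0.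
(* The main term is [u] if [Q] shrinks and [3/2 u] if only [S] does; the excess [u / 2] has
   probability at most 2/3. *)
rewrite /=; apply: (@le_trans _ _ (avg (fun x => (u / 2) *
      (heavy_count (upd x a) s.+1 (Q :\ j) < p * 4 ^+ m * nsub s.+1)%R%:R +
    (1 * (heavy_count (upd x a) s Q < p * 4 ^+ m * nsub s)%R%:R +
     (u + m%:R * err))))).
  apply: ler_avg => x; rewrite mul1r.
  case: (ltP (heavy_count (upd x a) s Q)) => hA.
    apply: le_trans (avgn_le1 _ _ _) _; rewrite mulr1n.
    by have := mulr_ge0 u0 (ler0n R (heavy_count (upd x a) s.+1 (Q :\ j) < p * 4 ^+ m * nsub s.+1)%R); lra.
  case: ltP => hB; rewrite ?mulr0n ?mulr1n ?mulr1 ?mulr0 ?add0r; last exact: (IH _ _ _ _ mE2 hs hQj QjE hB).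
  apply: le_trans (IH _ _ _ _ mE' (ltnW hs) hQ QE hA) _.
  by rewrite exprS -mulrA -/u; lra.
rewrite avg_lin avg_lin avg_cst -[in m.+1%:R]addn1 natrD !exprS.
have u20 : 0 <= u / 2 by rewrite divr_ge0.
have := ler_wpM2l u20 PB.
have -> : 3 / 2 * (3 / 2) ^+ q * (8 / 9 * (8 / 9) ^+ m) = 4 / 3 * u by rewrite /u; field.
move: PA; lra.
Qed.

End Fixed.
End Density.

(** * Combining the stages *)

Section Combine.
Variables (R : realFieldType) (n : nat).
Local Notation state := ({set 'I_n} -> R).
Implicit Types (a b : state) (A B C D E F S : {set 'I_n}).

Definition init_state : state := fun B => (B == set0)%:R.

Lemma energy_init C : energy C 0 init_state = 1.
Proof.
rewrite /energy (big_pred1 set0) => [|B]; first by rewrite /init_state eqxx expr1n.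
by rewrite cards_eq0; apply/andP/eqP => [[_ /eqP]|->] //; rewrite sub0set eqxx.
Qed.

(** Pigeonhole over at most [2 ^ n] minors. *)
Lemma exists_heavy C k b (L lam : R) : 0 <= L -> L ^+ 2 * 2 ^+ n < lam ->
  lam <= energy C k b ->
  exists A, [/\ A \subset C, #|A| = k & L <= `|b A|].
Proof.
move=> L0 hlam hE.
have [/existsP[A /and3P[h1 /eqP h2 h3]]|] :=
    boolP [exists A : {set 'I_n}, [&& A \subset C, #|A| == k & (L <= `|b A|)%R]].
  by exists A.
rewrite negb_exists => /forallP none; exfalso.
suff : energy C k b <= L ^+ 2 * 2 ^+ n by lra.
rewrite /energy; apply: (@le_trans _ _ (\sum_(B : {set 'I_n}) L ^+ 2)).
  rewrite big_mkcond; apply: ler_sum => B _; case: ifP => [/andP[h1 h2]|_]; last exact: sqr_ge0.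
  have := none B; rewrite h1 h2 /= -ltNge => /ltW h3.
  by rewrite -(real_normK (num_real (b B))) lerXn2r ?nnegrE.
rewrite sumr_const (_ : #|_| = 2 ^ n)%N; last first.
  by have := card_powerset [set: 'I_n]; rewrite powersetT !cardsT card_ord.
by rewrite -[_ *+ _]mulr_natr natrX.
Qed.

(** The first [g + j] rows use columns of [C] only and produce a heavy minor missing [t] of them;
    the next [t + q] rows absorb these [t] and [q] of the [2 q] columns of [D]. *)
Lemma fixed_missing C D (q t M Q g j : nat) (G p lam L : R) :
  [disjoint C & D] -> #|D| = (2 * q)%N -> (0 < n)%N -> (0 < M)%N -> (0 < Q)%N ->
  (2 * M <= t)%N -> 0 < G -> G * (4 * M%:R) <= t%:R ->
  Q%:R^-1 + 9 * Q%:R / M%:R <= p ->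
  (g + j + t)%N = #|C| -> lam * (2 * n%:R) ^+ j <= G ^+ g ->
  0 <= L -> L ^+ 2 * 2 ^+ n < lam ->
  avgn (g + j + (t + q)) (fun b => (~~ heavy_missing C D q L b)%:R) init_state <=
  2 ^+ (g + j) * p ^+ j.+1 + 2 * 2^-1 ^+ t + 3 * 2^-1 ^+ q.
Proof.
move=> dCD hD n0 M0 Q0 tM G0 GM pE hC hlam L0 hL.
have half_ge0 k : 0 <= 2^-1 ^+ k :> R by rewrite exprn_ge0 ?invr_ge0.
have q3 : 0 <= 3 * 2^-1 ^+ q :> R by rewrite mulr_ge0.
apply: le_trans (avgn_compose (g + j) (p := fun b => energy C (g + j) b < lam) _ q3 _) _.
  move=> b; rewrite -leNgt => /(exists_heavy L0 hL)[A [AC kA hA]].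
  have sA : A \subset C :|: D by apply: subset_trans AC _; exact: subsetUl.
  have e1 : #|C :\: A| = t by rewrite cardsD (setIidPr AC) kA -hC addKn.
  have e2 : #|D :\: A| = (2 * q)%N.
    rewrite -hD; congr #|pred_of_set _|; apply/setDidPl.
    by rewrite disjoint_sym; apply: disjointWl dCD.
  have hm : (t + q + q = t + 2 * q)%N by rewrite mul2n -addnn addnA.
  have hq : (q <= 2 * q)%N by rewrite mul2n -addnn leq_addr.
  apply: le_trans (absorb dCD sA e1 e2 hm hq hA) _.
  rewrite (_ : (2 * q - q)%N = q); last by rewrite mul2n -addnn addnK.
  have := half_ge0 t; have := half_ge0 q; have := half_ge0 (t + 2 * q)%N.
  move: (2^-1 ^+ t) (2^-1 ^+ q) (2^-1 ^+ (t + 2 * q)) => y z w h1 h2 h3.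
  have := mulr_ge0 h2 h3; nra.
rewrite lerD2r; have hC' : (0 + (g + j) + t)%N = #|C| by rewrite add0n.
have hlam' : lam * (2 * n%:R) ^+ j <= energy C 0 init_state * G ^+ g.
  by rewrite energy_init mul1r.
have := energy_iterate n0 M0 Q0 tM G0 GM pE (erefl (g + j)%N) hC' hlam'.
rewrite add0n => h; apply: le_trans h _.
rewrite lerD2l ler_wpM2l // lerBlDr lerDl //.
Qed.

(** The threshold is one half, shared among the [2 ^ #|D|] subsets of [D]. *)
Definition spread D s q (L : R) b : bool :=
  [exists Q : {set 'I_n}, [&& Q \subset D, #|Q| == q &
     (2^-1 ^+ (#|D|.+1) * nsub R (~: D) s <= heavy_count (~: D) L b s Q)%R]].

(* Pigeonhole over the at most [2 ^ #|D|] possible sets [Q]. *)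
Lemma not_spread_le D s q (L : R) b : 0 < nsub R (~: D) s ->
  (~~ spread D s q L b)%:R <= 2 / nsub R (~: D) s *
    \sum_(S : {set 'I_n} | (S \subset ~: D) && (#|S| == s))
       (~~ heavy_missing (~: D :\: S) D q L b)%:R.
Proof.
set N := nsub R (~: D) s => N0.
set Z := \sum_(_ | _) _.
have Z0 : 0 <= Z by apply: sumr_ge0 => S _; exact: ler0n.
have [_|] := boolP (spread D s q L b).
  by rewrite mulr_ge0 // divr_ge0 // ltW.
rewrite negb_exists => /forallP none.
rewrite mulr1n mulrAC ler_pdivlMr // mul1r leNgt; apply/negP => hZ.
have : N - Z <= \sum_(Q : {set 'I_n} | (Q \subset D) && (#|Q| == q))
                   heavy_count (~: D) L b s Q.
  rewrite /heavy_count exchange_big /= /N /nsub -sumrB; apply: ler_sum => S /andP[SD _].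
  have s0 : 0 <= \sum_(Q : {set 'I_n} | (Q \subset D) && (#|Q| == q))
      (L <= `|b (~: (S :|: Q))|)%R%:R :> R.
    by apply: sumr_ge0 => Q _; exact: ler0n.
  have [/existsP[Q /and3P[QD kQ hQ]]|_] := boolP (heavy_missing _ _ _ _ _); last by rewrite subrr.
  rewrite subr0 (bigD1 Q) /=; last by rewrite QD.
  rewrite (_ : ~: (S :|: Q) = ((~: D :\: S) :|: D) :\: Q); last first.
    apply/setP => i; rewrite !inE negb_or.
    have [iD|iD] := boolP (i \in D); rewrite ?orbT ?orbF /= ?andbT ?andbF.
      suff -> : i \notin S by [].
      by apply: contraL iD => /(subsetP SD); rewrite inE.
    suff -> : i \notin Q by case: (i \in S).
    by apply: contra iD => /(subsetP QD).
  by rewrite hQ lerDl; apply: sumr_ge0 => Q' _; exact: ler0n.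
suff : \sum_(Q : {set 'I_n} | (Q \subset D) && (#|Q| == q)) heavy_count (~: D) L b s Q
    <= N / 2 by lra.
have c0 : 0 <= 2^-1 ^+ (#|D|.+1) * N by rewrite mulr_ge0 ?exprn_ge0 ?invr_ge0 // ltW.
apply: (@le_trans _ _ (\sum_(Q in powerset D) 2^-1 ^+ (#|D|.+1) * N)).
  rewrite big_mkcond [leRHS]big_mkcond /=; apply: ler_sum => Q _.
  rewrite powersetE; case: ifP => [/andP[QD kQ]|_]; last by case: ifP.
  by rewrite QD; have := none Q; rewrite QD kQ /= -ltNge => /ltW.
rewrite sumr_const card_powerset -[_ *+ _]mulr_natl natrX exprS mulrA mulrA.
have -> : 2 ^+ #|D| / 2 * 2^-1 ^+ #|D| * N = (2 / 2) ^+ #|D| * (N / 2).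
  by rewrite exprMn; ring.
by rewrite divff ?pnatr_eq0 // expr1n mul1r.
Qed.

Lemma nsub_gt0 E s : (s <= #|E|)%N -> 0 < nsub R E s.
Proof.
move=> hs; have -> : nsub R E s = 'C(#|E|, s)%:R.
  by rewrite -cards_draws -sum1_card natr_sum; apply: eq_bigl => S; rewrite inE.
by rewrite ltr0n bin_gt0.
Qed.

(** [fixed_missing] is applied to the complement of [D] deprived of each [S]; Markov over [S]
    doubles its error, and the endgame adds its own. *)
Lemma permanent_state_bound D (q t M Q g j h q0 : nat) (G p lam L : R) :
  #|D| = (2 * q)%N -> (0 < n)%N -> (0 < M)%N -> (0 < Q)%N ->
  (2 * M <= t)%N -> 0 < G -> G * (4 * M%:R) <= t%:R ->
  Q%:R^-1 + 9 * Q%:R / M%:R <= p ->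
  (g + j + t + 9 * q)%N = n -> lam * (2 * n%:R) ^+ j <= G ^+ g ->
  0 < L -> L ^+ 2 * 2 ^+ n < lam ->
  (0 < h)%N -> (0 < q0)%N -> h%:R <= 2^-1 ^+ (18 * q) * (n - 9 * q)%:R :> R ->
  avgn n (fun b => (`|b [set: 'I_n]| < L)%R%:R) init_state <=
  2 * (2 ^+ (g + j) * p ^+ j.+1 + 2 * 2^-1 ^+ t + 3 * 2^-1 ^+ q)
  + ((3 / 2) ^+ q * (8 / 9) ^+ (8 * q) + (8 * q)%:R * (2 * (q0%:R^-1 + q0%:R / h%:R))).
Proof.
move=> hD n0 M0 Q0 tM G0 GM pE hn hlam L0 hL h0 q00 hh.
set beta := 2 ^+ (g + j) * p ^+ j.+1 + _ + _.
set e2 := _ + (8 * q)%:R * _.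
(* With [q] columns left in the fixed part, there are [8 q] final rows, enough for
   [3/2 * (8/9)^8 <= 3/5] later. *)
pose E := ~: D; pose s := (7 * q)%N.
have cE : #|E| = (n - 2 * q)%N.
  by have := cardsC D; rewrite card_ord hD -/E; clear; lia.
have hs : (s <= #|E|)%N by rewrite cE /s; clear - hn; lia.
have N0 := nsub_gt0 hs.
have e20 : 0 <= e2.
  by rewrite addr_ge0 ?mulr_ge0 ?exprn_ge0 ?divr_ge0 ?addr_ge0 ?invr_ge0 ?divr_ge0.
have nE : n = (g + j + (t + q) + (s + q))%N by rewrite /s; clear - hn; lia.
suff : avgn (g + j + (t + q) + (s + q)) (fun b => (`|b [set: 'I_n]| < L)%R%:R) init_state
    <= 2 * beta + e2 by rewrite -nE.
apply: le_trans (avgn_compose _ (p := fun b => ~~ spread D s q L b) _ e20 _) _.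
  move=> b; rewrite negbK => /existsP[X /and3P[XD /eqP kX hX]].
  have -> : e2 = (3 / 2) ^+ q * (8 / 9) ^+ (s + q) + (s + q)%:R *
      (2 * (q0%:R^-1 + q0%:R / h%:R)).
    by rewrite /e2 (_ : (s + q)%N = (8 * q)%N) // /s; clear; lia.
  (* The density may shrink by 4 at each of the [8 q] rows, so that [2 p' = 2^-(18 q)]. *)
  pose p' : R := 2^-1 ^+ (#|D|.+1) * 4^-1 ^+ (s + q).
  have p'0 : 0 < p' by rewrite mulr_gt0 ?exprn_gt0 ?invr_gt0.
  have hh' : h%:R <= 2 * p' * (#|E| - s)%:R.
    apply: le_trans hh _; rewrite le_eqVlt; apply/orP; left; apply/eqP.
    rewrite cE (_ : (n - 2 * q - s)%N = (n - 9 * q)%N); last by rewrite /s; clear - hn; lia.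
    congr (_ * _); rewrite /p' hD exprS (_ : 4^-1 = 2^-1 ^+ 2); last by rewrite exprVn -natrX.
    rewrite -exprM mulrA mulrA divff ?pnatr_eq0 // mul1r -exprD; congr (_ ^+ _).
    by rewrite /s; clear; lia.
  apply: (density_endgame (p := p') L0 p'0 h0 q00 hh' (erefl _) (leqnn s) kX).
    by rewrite /E setCK.
  rewrite /p' -[X in X * _ <= _]mulrA -exprMn mulVf ?pnatr_eq0 // expr1n mulr1.
  exact: hX.
rewrite lerD2r.
apply: le_trans (ler_avgn _ _ (fun b => not_spread_le q L b N0)) _.
rewrite (@eq_avgn _ _ _ _ (fun b => 2 / nsub R E s * \sum_(S : {set 'I_n} |
   (S \subset ~: D) && (#|S| == s)) (~~ heavy_missing (~: D :\: S) D q L b)%:R + 0)); last first.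
  by move=> b; rewrite addr0.
rewrite avgn_lin avgn_cst addr0 avgn_sum.
rewrite (_ : 2 * beta = 2 / nsub R E s * (beta * nsub R E s)); last by field; rewrite gt_eqF.
rewrite ler_wpM2l ?divr_ge0 ?(ltW N0) // /nsub mulr_sumr; apply: ler_sum => S /andP[SE /eqP kS].
have dS : [disjoint ~: D :\: S & D].
  by rewrite disjoint_sym disjoints_subset; apply/subsetP => i iD; rewrite !inE iD andbF.
have cS : (g + j + t)%N = #|~: D :\: S|.
  by rewrite cardsD (setIidPr SE) cE kS /s; clear - hn; lia.
rewrite mulr1.
exact: (fixed_missing dS hD n0 M0 Q0 tM G0 GM pE cS hlam (ltW L0) hL).
Qed.

End Combine.

(** * Choice of the parameters *)

Section Numerics.
Variables (R : realFieldType).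

Lemma exists_set_card n k : (k <= n)%N -> exists D : {set 'I_n}, #|D| = k.
Proof.
move=> kn; have : (0 < #|[set A : {set 'I_n} | #|A| == k]|)%N.
  by rewrite card_draws card_ord bin_gt0.
by case/card_gt0P => D; rewrite inE => /eqP; exists D.
Qed.

(** With these values of [Q] and [M], a bad row has probability at most [2 / Q = 2^-(2 d)]. *)
Definition row_precision (d : nat) : nat := 2 ^ (2 * d).+1.
Definition row_blocks (d : nat) : nat := 9 * row_precision d * row_precision d.

(** Takes [j = t = n %/ d], [h = 2^(20 q)] and [q0 = 2^(2 q)]. Every error is a multiple of
    [(3/5)^q], and 45 is [2 (1 + 2 + 3) + 1 + 32]. *)
Lemma permanent_state_bound_num n q d (L : R) :
  (0 < q)%N -> (2 < d)%N -> (2 ^ (40 * q) <= n)%N ->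
  (2 * row_blocks d <= n %/ d)%N -> (9 * q <= n %/ d)%N -> 0 < L ->
  L ^+ 2 * 2 ^+ n * (2 * n%:R) ^+ (n %/ d) <
    ((n %/ d)%:R / (4 * (row_blocks d)%:R)) ^+ (n - 9 * q - 2 * (n %/ d)) ->
  avgn n (fun b => (`|b [set: 'I_n]| < L)%R%:R) (@init_state R n) <= 45 * (3 / 5) ^+ q.
Proof.
set Q := row_precision d; set M := row_blocks d; set t := (n %/ d)%N.
move=> q0 d2 hn tM qt L0.
have d0 : (0 < d)%N by apply: leq_trans d2.
have tdn : (t * d <= n)%N by exact: leq_trunc_div.
have ndt : (n < t.+1 * d)%N by exact: ltn_ceil.
have t3n : (3 * t <= n)%N.
  by apply: leq_trans tdn; rewrite mulnC leq_mul2l d2 orbT.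
have Q0 : (0 < Q)%N by rewrite expn_gt0.
have M0 : (0 < M)%N by rewrite !muln_gt0 Q0.
have QR : 0 < Q%:R :> R by rewrite ltr0n.
have MR : 0 < M%:R :> R by rewrite ltr0n.
have t0 : (0 < t)%N by apply: leq_trans tM; rewrite muln_gt0.
have tR : 0 < t%:R :> R by rewrite ltr0n.
have n0 : (0 < n)%N by apply: leq_trans t3n; rewrite muln_gt0.
have nR : 0 < 2 * n%:R :> R by rewrite mulr_gt0 ?ltr0n.
set g := (n - 9 * q - 2 * t)%N => hL.
have gE : (g + t + t + 9 * q)%N = n by rewrite /g; clear - qt t3n; lia.
pose G : R := t%:R / (4 * M%:R).
have G0 : 0 < G by rewrite divr_gt0 ?mulr_gt0.
have GM : G * (4 * M%:R) <= t%:R by rewrite divfK // gt_eqF // mulr_gt0.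
pose h2 : R := 2^-1.
have h20 k : 0 <= h2 ^+ k by rewrite exprn_ge0 ?invr_ge0.
have h2le (k l : nat) : (k <= l)%N -> h2 ^+ l <= h2 ^+ k.
  by move=> kl; rewrite ler_wiXn2l ?invr_ge0 // invf_le1 // ler1n.
have pow2V k : (2 ^ k)%:R^-1 = h2 ^+ k :> R by rewrite natrX exprVn.
have pow2K k l : 2 ^+ k * h2 ^+ (k + l) = h2 ^+ l.
  by rewrite exprD mulrA -exprMn divff ?pnatr_eq0 // expr1n mul1r.
have pE : Q%:R^-1 + 9 * Q%:R / M%:R <= h2 ^+ (2 * d).
  have -> : 9 * Q%:R / M%:R = Q%:R^-1 :> R.
    by rewrite /M /row_blocks -/Q !natrM; field; rewrite ?gt_eqF.
  rewrite /Q /row_precision pow2V exprS /h2; lra.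
have [D hD] : exists D : {set 'I_n}, #|D| = (2 * q)%N.
  by apply: exists_set_card; clear - qt t3n; lia.
pose lam := G ^+ g / (2 * n%:R) ^+ t.
have hlam : lam * (2 * n%:R) ^+ t <= G ^+ g by rewrite divfK // expf_neq0 // gt_eqF.
have hL' : L ^+ 2 * 2 ^+ n < lam by rewrite ltr_pdivlMr ?exprn_gt0.
have hh : (2 ^ (20 * q))%:R <= 2^-1 ^+ (18 * q) * (n - 9 * q)%:R :> R.
  rewrite exprVn mulrC ler_pdivlMr ?exprn_gt0 // -natrX -natrM ler_nat -expnD.
  have hn2 : (2 * 2 ^ (38 * q) <= n)%N.
    by apply: leq_trans hn; rewrite -expnS leq_exp2l //; clear - q0; lia.
  rewrite (_ : (20 * q + 18 * q)%N = (38 * q)%N); last by clear; lia.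
  move: hn2; set z := (2 ^ (38 * q))%N; clear - qt t3n; lia.
have h0 : (0 < 2 ^ (20 * q))%N by rewrite expn_gt0.
have q00 : (0 < 2 ^ (2 * q))%N by rewrite expn_gt0.
have := permanent_state_bound hD n0 M0 Q0 tM G0 GM pE gE hlam L0 hL' h0 q00 hh.
move=> H; apply: le_trans H _.
have q_le : h2 ^+ q <= (3 / 5) ^+ q.
  by rewrite lerXn2r ?nnegrE ?divr_ge0 ?invr_ge0 // /h2; lra.
(* Since [(t + 1) d > n], the power of [p] is at most [2^-(2 n)] and beats the number of
   placements. *)
have b1 : 2 ^+ (g + t) * (h2 ^+ (2 * d)) ^+ t.+1 <= h2 ^+ q.
  rewrite -exprM -(pow2K (g + t)%N q) ler_wpM2l ?exprn_ge0 // h2le //.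
  have : (2 * d * t.+1 = 2 * (t.+1 * d))%N by clear; lia.
  by clear - ndt gE; lia.
have b2 : 2^-1 ^+ t <= h2 ^+ q by apply: h2le; clear - qt; lia.
have b3 : (3 / 2) ^+ q * (8 / 9) ^+ (8 * q) <= (3 / 5) ^+ q :> R.
  have c : 3 / 2 * (8 / 9) ^+ 8 <= 3 / 5 :> R by lra.
  rewrite exprM -exprMn; apply: lerXn2r => //; rewrite nnegrE; lra.
have b4 : (8 * q)%:R * (2 * ((2 ^ (2 * q))%:R^-1 + (2 ^ (2 * q))%:R / (2 ^ (20 * q))%:R))
   <= 32 * h2 ^+ q.
  have -> : (2 ^ (2 * q))%:R / (2 ^ (20 * q))%:R = h2 ^+ (18 * q).
    rewrite pow2V natrX (_ : (20 * q)%N = (2 * q + 18 * q)%N) ?pow2K //; clear; lia.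
  have c1 : h2 ^+ (18 * q) <= h2 ^+ (2 * q) by apply: h2le; clear; lia.
  have c2 : q%:R * h2 ^+ q <= 1.
    rewrite -pow2V ler_pdivrMr ?ltr0n ?expn_gt0 // mul1r ler_nat.
    by rewrite ltnW // ltn_expl.
  rewrite pow2V natrM.
  have c3 : h2 ^+ (2 * q) = h2 ^+ q * h2 ^+ q by rewrite -exprD addnn mul2n.
  have c4 : q%:R * h2 ^+ (2 * q) <= h2 ^+ q.
    by rewrite c3 mulrA -[leRHS]mul1r ler_wpM2r.
  have c5 : q%:R * h2 ^+ (18 * q) <= q%:R * h2 ^+ (2 * q) by rewrite ler_wpM2l.
  move: c4 c5; set y := h2 ^+ (2 * q); set w := h2 ^+ (18 * q); lra.
rewrite -/h2 in b2 *; move: q_le b1 b2 b3 b4.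
set y1 := _ * _ ^+ t.+1; set y4 := (8 * q)%:R * _; set y3 := _ * (8 / 9) ^+ _.
move: (h2 ^+ q) (h2 ^+ t) ((3 / 5) ^+ q) y1 y3 y4 => *; lra.
Qed.

End Numerics.

(** * The row process computes the permanent *)

Section Expansion.
Variables (R : realFieldType) (n : nat).
Local Notation row := {ffun 'I_n -> bool}.
Local Notation state := ({set 'I_n} -> R).

Lemma avgn_tuple m f a :
  avgn m f a = (\sum_(t : m.-tuple row) f (foldl (fun b x => @upd R n x b) a t)) / 2 ^+ (n * m).
Proof.
elim: m a => [|m IH] a /=.
  rewrite muln0 expr0 divr1 (big_pred1 [tuple]) // => t.
  by apply/esym/eqP/val_inj; case: t => -[].
rewrite /avg (eq_bigr _ (fun x _ => IH (upd x a))).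
rewrite -mulr_suml -mulrA -invfM -exprD mulnS addnC; congr (_ / _).
rewrite pair_big /=.
rewrite (reindex (fun t : m.+1.-tuple row => (thead t, [tuple of behead t]))) /=; last first.
  exists (fun p : row * m.-tuple row => [tuple of p.1 :: p.2]).
    by move=> t _; apply: val_inj; case/tupleP: t => x t; rewrite /= theadE.
  by move=> [x t] _; congr pair; apply: val_inj.
by apply: eq_bigr => t _; case/tupleP: t => x t; rewrite /= theadE.
Qed.

(** Iterated expansion along the rows: [t] lists the column chosen in each row. *)
Lemma foldl_upd m (xs : m.-tuple row) a B :
  foldl (fun b x => @upd R n x b) a xs B =
  \sum_(t : m.-tuple 'I_n | uniq t && all (mem B) t)
     (\prod_(i < m) (-1) ^+ (tnth xs i (tnth t i))) * a (B :\: [set i in t]).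
Proof.
elim: m xs a B => [|m IH] xs a B.
  have -> : xs = [tuple] by apply: val_inj; case: xs => -[].
  rewrite (big_pred1 [tuple]) => [|t]; last first.
    have -> : t = [tuple] by apply: val_inj; case: t => -[].
    by rewrite /= eqxx.
  by rewrite big_ord0 mul1r (_ : [set i in [tuple]] = set0) ?setD0 //; apply/setP => i; rewrite !inE.
case/tupleP: xs => x xs /=; rewrite IH.
rewrite [RHS](reindex (fun p : 'I_n * m.-tuple 'I_n => [tuple of p.1 :: p.2])) /=; last first.
  exists (fun t : m.+1.-tuple 'I_n => (thead t, [tuple of behead t])).
    by move=> [j t] _; congr pair; apply: val_inj.
  by move=> t _; apply: val_inj; case/tupleP: t => j t; rewrite /= theadE.
(* The first row is the innermost expansion: its column is chosen among those left by the later
   rows. *)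
rewrite (eq_bigr (fun t : m.-tuple 'I_n => \sum_(j in B :\: [set i in t])
  (\prod_(i < m) (-1) ^+ (tnth xs i (tnth t i))) *
     ((-1) ^+ (x j) * a (B :\: [set i in t] :\ j)))); last first.
  by move=> t _; rewrite /upd mulr_sumr.
rewrite pair_big_dep /= (reindex (fun p : 'I_n * m.-tuple 'I_n => (p.2, p.1))) /=; last first.
  by exists (fun p => (p.2, p.1)) => [] [].
apply: eq_big => [[j t]|[j t] _] /=.
  by rewrite !inE; case: (uniq t); case: (all _ t); case: (j \in t); case: (j \in B).
rewrite big_ord_recl !tnth0 mulrA; congr (_ * _).
  by rewrite mulrC; congr (_ * _); apply: eq_bigr => i _; rewrite !tnthS.
by congr a; apply/setP => i; rewrite !inE; case: (i == j); case: (i \in t).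
Qed.

(** Repetition-free [n]-tuples of columns are permutations; they exhaust the columns, where
    [init_state] is 1. *)
Lemma foldl_upd_perm (xs : n.-tuple row) :
  foldl (fun b x => @upd R n x b) (@init_state R n) xs [set: 'I_n] =
  \sum_(s : 'S_n) \prod_(i < n) (-1) ^+ (tnth xs i (s i)).
Proof.
rewrite foldl_upd (reindex_omap (fun s : 'S_n => [tuple s i | i < n])
   (fun t : n.-tuple 'I_n => insub [ffun i => tnth t i])) /=; last first.
  move=> t /andP[ut _]; have inj : injectiveb [ffun i => tnth t i].
    apply/injectiveP => i j; rewrite !ffunE => /eqP.
    by rewrite !(tnth_nth i) nth_uniq ?size_tuple // => /eqP/val_inj.
  rewrite (insubT (fun f : {ffun 'I_n -> 'I_n} => injectiveb f) inj) /=.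
  congr Some; apply: eq_from_tnth => i; rewrite tnth_mktuple.
  by rewrite -pvalE /= ffunE.
apply: eq_big => [s|s /andP[/andP[us _] _]].
  have us : uniq [tuple s i | i < n].
    by rewrite map_inj_uniq ?val_ord_tuple ?enum_uniq //; exact: perm_inj.
  have -> : all (mem [set: 'I_n]) [tuple s i | i < n] by apply/allP => i _; rewrite inE.
  rewrite us /=; have -> : [ffun i => tnth [tuple s i | i < n] i] = val s.
    by apply/ffunP => i; rewrite ffunE tnth_mktuple -pvalE.
  by rewrite valK eqxx.
rewrite (_ : [set: 'I_n] :\: _ = set0).
  by rewrite /init_state eqxx mulr1; apply: eq_bigr => i _; rewrite tnth_mktuple.
apply/setP => i; rewrite !inE andbT; apply/negbTE; rewrite negbK.
by apply/mapP; exists (s^-1%g i); rewrite ?mem_ord_enum ?val_ord_tuple ?mem_enum // permKV.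
Qed.

End Expansion.

Require Import Defs.
Local Open Scope classical_set_scope.
Local Open Scope ring_scope.

(** * Random sign matrices *)

Section SignMatrices.
Variables (R : realType) (n : nat) (d : measure_display) (T : measurableType d).
Variables (P : probability T R) (X : 'I_n -> 'I_n -> {RV P >-> R}).
Hypothesis indepX : mutually_independent (fun ij : 'I_n * 'I_n => X ij.1 ij.2).
Hypothesis signX : forall i j, random_sign (X i j).
Local Notation row := {ffun 'I_n -> bool}.

Let sign_event (xs : n.-tuple row) : set T :=
  \bigcap_(ij in [set` setTfor ('I_n * 'I_n)%type])
    (X ij.1 ij.2 @^-1` [set (-1) ^+ (tnth xs ij.1 ij.2)]).

Let sign_eventP xs w : sign_event xs w <-> forall i j, X i j w = (-1) ^+ (tnth xs i j).
Proof.
split=> [h i j|h [i j] _]; last exact: h.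
by have := h (i, j); apply; rewrite /= inE.
Qed.

Let measurable_sign_event xs : measurable (sign_event xs).
Proof.
by apply: fin_bigcap_measurable.
Qed.

Let prob_sign_event xs : P (sign_event xs) = ((2 ^+ (n * n))^-1)%:E.
Proof.
rewrite (indepX (B := fun ij => [set (-1) ^+ (tnth xs ij.1 ij.2)])); last first.
  by move=> ij _; exact: measurable_set1.
rewrite (eq_bigr (fun=> (2^-1)%:E)) => [|ij _]; last first.
  by have [h1 h2] := signX ij.1 ij.2; case: (tnth xs _ _); rewrite ?expr1 ?expr0.
rewrite prodEFin prodr_const.
by rewrite cardsT card_prod card_ord exprVn.
Qed.

Lemma random_mx_permanent_tuple xs w : sign_event xs w ->
  permanent (random_mx X w) =
  foldl (fun b x => @upd R n x b) (@init_state R n) xs (setTfor 'I_n).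
Proof.
move=> /sign_eventP h; rewrite foldl_upd_perm; apply: eq_bigr => s _.
by apply: eq_bigr => i _; rewrite mxE h.
Qed.

Lemma measurable_permanent : measurable_fun setT (fun w => permanent (random_mx X w)).
Proof.
apply: measurable_sum => s; apply: measurable_prod => i _.
rewrite (_ : (fun w => random_mx X w i (s i)) = X i (s i)); first exact: measurable_funPT.
by apply/funext => w; rewrite mxE.
Qed.

(** The sign patterns define disjoint events of probability [2^-(n n)]. Outcomes with an entry other
    than a sign are discarded, which an inequality allows. *)
Lemma prob_permanent_ge (L : R) :
  ((1 - avgn n (fun b => (`|b (setTfor 'I_n)| < L)%R%:R) (@init_state R n))%:E <=
   P [set w | (L <= `|permanent (random_mx X w)|)%R])%E.
Proof.
pose per (xs : n.-tuple row) : R :=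
  foldl (fun b x => @upd R n x b) (@init_state R n) xs (setTfor 'I_n).
pose good := enum [pred xs : n.-tuple row | (L <= `|per xs|)%R].
have mgood : measurable (\bigcup_(xs in [set` good]) sign_event xs).
  by apply: fin_bigcup_measurable => // xs _.
apply: (@le_trans _ _ (P (\bigcup_(xs in [set` good]) sign_event xs))); last first.
  apply: le_measure; rewrite ?inE //.
    have -> : [set w | L <= `|permanent (random_mx X w)|] =
      setT `&` [set w | L <= `|permanent (random_mx X w)|] by rewrite setTI.
    apply: measurable_fun_le => //.
    by apply: measurableT_comp => //; exact: measurable_permanent.
  move=> w [xs]; rewrite /= mem_enum inE => hL hw.
  by rewrite (random_mx_permanent_tuple hw).
rewrite measure_fin_bigcup //; last first.
  apply/trivIsetP => xs ys _ _ neq; apply/seteqP; split=> w // [].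
  move=> /sign_eventP h1 /sign_eventP h2; case/eqP: neq.
  apply: eq_from_tnth => i; apply/ffunP => j.
  have := h1 i j; rewrite h2 => /eqP; rewrite -subr_eq0.
  by case: (tnth xs i j); case: (tnth ys i j) => //; rewrite ?expr1 ?expr0 => /eqP; lra.
rewrite -fsbig_seq ?enum_uniq // big_enum /=.
rewrite (eq_bigr (fun=> ((2 ^+ (n * n))^-1)%:E)) => [|xs _]; last exact: prob_sign_event.
rewrite sumEFin lee_fin avgn_tuple.
have N0 : 0 < 2 ^+ (n * n) :> R by rewrite exprn_gt0.
have one : (\sum_(xs : n.-tuple row) 1) / 2 ^+ (n * n) = 1 :> R.
  by rewrite sumr_const card_tuple card_ffun card_bool card_ord -expnM natrX divff ?gt_eqF.
rewrite -[X in X - _]one -mulrBl -sumrB mulr_suml [leRHS]big_mkcond /=; apply: ler_sum => xs _.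
rewrite inE -/(per xs) ltNge.
by case: (L <= `|per xs|); rewrite ?subr0 ?subrr ?mul1r ?mul0r.
Qed.

End SignMatrices.

(** * Asymptotics in [n] *)

Section Asymptotics.
Variable R : realType.

(** With [t = n %/ d], the right side is at least [(n / K)^(n - 3 t)] and the left about
    [n^((1 - 2 eps) n + t)]. As [4 t <= eps n], a factor [n^(eps n)] remains to beat [(4 K)^n]. *)
Lemma threshold_eventually (eps : R) : 0 < eps ->
  exists d N : nat, (2 < d)%N /\ forall n q : nat, (N <= n)%N -> (9 * q <= n %/ d)%N ->
    [/\ (0 < n)%N, (2 * row_blocks d <= n %/ d)%N &
     (n%:R `^ ((2^-1 - eps) * n%:R)) ^+ 2 * 2 ^+ n * (2 * n%:R) ^+ (n %/ d) <
      ((n %/ d)%:R / (4 * (row_blocks d)%:R)) ^+ (n - 9 * q - 2 * (n %/ d)) :> R].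
Proof.
move=> eps0; pose d := (Num.bound (4 / eps)).+3.
have d2 : (2 < d)%N by [].
have d0 : (0 < d)%N by [].
have dR : 0 < d%:R :> R by rewrite ltr0n.
have d_eps : 4 <= eps * d%:R.
  rewrite mulrC -ler_pdivrMr //; apply: le_trans (ltW (archi_boundP _)) _.
    by rewrite divr_ge0 // ltW.
  by rewrite ler_nat; exact: (leq_addl 3).
clearbody d.
exists d.
have M0 : (0 < row_blocks d)%N by rewrite !muln_gt0 /row_precision expn_gt0.
move: (row_blocks d) M0 => M M0.
have MR : 1 <= M%:R :> R by rewrite ler1n.
(* From [n <= 2 d t] follows [n / K <= t / (4 M)]. *)
pose K : R := 8 * d%:R * M%:R.
have K1 : 1 <= K.
  by rewrite /K -!natrM ler1n muln_gt0 M0 muln_gt0 d0.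
have K0 : 0 < K by apply: lt_le_trans K1.
(* Beyond [x0], [n^eps > 4 K]; the 4 covers [2^n * 2^t]. *)
pose x0 : R := (4 * K) `^ eps^-1.
exists (maxn (maxn (2 * d) (2 * M * d)) (Num.bound x0)); split=> // n q.
rewrite !geq_max => /andP[/andP[n2d n2M] nx0] q9.
have n0 : (0 < n)%N by apply: leq_trans n2d; rewrite muln_gt0.
have tM : (2 * M <= n %/ d)%N by rewrite leq_divRL.
split=> //; move: q9 tM; set t := (n %/ d)%N => q9 tM.
have tdn : (t * d <= n)%N by exact: leq_trunc_div.
have ndt : (n < t.+1 * d)%N by exact: ltn_ceil.
set g := (n - 9 * q - 2 * t)%N.
have nR : 1 <= n%:R :> R by rewrite ler1n.
have nR0 : 0 < n%:R :> R by rewrite ltr0n.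
have t3 : (t * 3 <= n)%N by apply: leq_trans tdn; rewrite leq_mul2l d2 orbT.
have gE : (n <= g + 3 * t)%N by rewrite /g; clear - q9 t3; lia.
have gn : (g <= n)%N by rewrite /g -subnDA leq_subr.
have tn : (t <= n)%N by exact: leq_div.
have tR : 4 * t%:R <= eps * n%:R :> R.
  have : t%:R * d%:R <= n%:R :> R by rewrite -natrM ler_nat.
  have := ler_wpM2l (ler0n R t) d_eps.
  by move=> h1 h2; have := ler_wpM2l (ltW eps0) h2; lra.
have base : n%:R / K <= t%:R / (4 * M%:R).
  rewrite ler_pdivrMr // mulrAC ler_pdivlMr; last by rewrite mulr_gt0 // (lt_le_trans ltr01).
  have : (n <= 2 * d * t)%N by clear - ndt n2d; lia.
  rewrite -(ler_nat R) !natrM => h; rewrite /K.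
  have -> : t%:R * (8 * d%:R * M%:R) = (2 * d%:R * t%:R) * (4 * M%:R) :> R by ring.
  by rewrite ler_wpM2r // mulr_ge0.
have nK0 : 0 <= n%:R / K :> R by rewrite divr_ge0 // ltW.
have powb : (n%:R / K) ^+ g <= (t%:R / (4 * M%:R)) ^+ g.
  by apply: lerXn2r => //; rewrite nnegrE // divr_ge0 // mulr_ge0.
apply: (lt_le_trans _ powb).
rewrite expr_div_n ltr_pdivlMr ?exprn_gt0 //.
set L2 := _ `^ _ ^+ 2.
have L2E : L2 = n%:R `^ ((1 - 2 * eps) * n%:R).
  rewrite /L2 -powR_mulrn ?powR_ge0 // -powRrM; congr (_ `^ _).
  by field.
have L20 : 0 < L2 by rewrite exprn_gt0 // powR_gt0.
have big : (4 * K) ^+ n < n%:R `^ (eps * n%:R).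
  rewrite powRrM powR_mulrn ?powR_ge0 //.
  have K4 : 4 * K < n%:R `^ eps.
    have -> : 4 * K = x0 `^ eps.
      by rewrite /x0 -powRrM mulVf ?gt_eqF // powRr1 // mulr_ge0 // ltW.
    apply: gt0_ltr_powR; rewrite ?nnegrE ?powR_ge0 //.
    by apply: lt_le_trans (archi_boundP (powR_ge0 _ _)) _; rewrite ler_nat.
  by rewrite ltr_pXn2r ?nnegrE ?powR_ge0 // mulr_ge0 // ltW.
apply: (@lt_le_trans _ _ (L2 * n%:R `^ t%:R * n%:R `^ (eps * n%:R))).
  rewrite exprMn powR_mulrn //.
  apply: (@le_lt_trans _ _ (L2 * n%:R ^+ t * (4 * K) ^+ n)); last first.
    by rewrite ltr_pM2l // mulr_gt0 // exprn_gt0.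
  have -> : L2 * 2 ^+ n * (2 ^+ t * n%:R ^+ t) * K ^+ g =
      L2 * n%:R ^+ t * (2 ^+ n * 2 ^+ t * K ^+ g) by ring.
  rewrite ler_wpM2l ?mulr_ge0 ?(ltW L20) ?exprn_ge0 //.
  rewrite [(4 * K) ^+ n]exprMn; apply: ler_pM; rewrite ?mulr_ge0 ?exprn_ge0 ?(ltW K0) //; last first.
    by rewrite ler_weXn2l.
  have -> : 4 ^+ n = 2 ^+ n * 2 ^+ n :> R by rewrite -exprMn -natrM.
  by rewrite ler_wpM2l ?exprn_ge0 // ler_weXn2l // ler1n.
rewrite L2E -powRD ?(gt_eqF nR0) ?implybT // -powRD ?(gt_eqF nR0) ?implybT //.
rewrite -powR_mulrn //; apply: ler_powR => //.
have : n%:R <= g%:R + 3 * t%:R :> R by rewrite -natrM -natrD ler_nat.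
lra.
Qed.

(** Here [n^c] is at most [2^((q + 1) / 10) <= (11/10)^(q + 1)], and [3/5 * 11/10 < 1]; taking
    [q >= 10] absorbs the constant. *)
Lemma failure_le_powR (n q : nat) (c : R) : 0 <= c -> 40 * c = 10^-1 ->
  (10 <= q)%N -> (0 < n)%N -> (n <= 2 ^ (40 * q.+1))%N ->
  45 * (3 / 5) ^+ q <= n%:R `^ (- c) :> R.
Proof.
move=> c0 hc q10 n0 hn; rewrite powRN.
have nR0 : 0 < n%:R :> R by rewrite ltr0n.
pose z : R := 2 `^ 10^-1.
have z0 : 0 < z by rewrite powR_gt0.
have z10 : z ^+ 10 = 2.
  by rewrite -powR_mulrn ?powR_ge0 // -powRrM mulVf // powRr1.
have zle : z <= 11 / 10.
  rewrite leNgt; apply/negP => h.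
  have : (11 / 10) ^+ 10 < z ^+ 10 by rewrite ltr_pXn2r ?nnegrE ?(ltW z0).
  rewrite z10; lra.
have hz : n%:R `^ c <= z ^+ q.+1.
  have -> : z ^+ q.+1 = (2 ^ (40 * q.+1))%:R `^ c.
    rewrite natrX -(powR_mulrn _ (powR_ge0 _ _)) -(powR_mulrn _ (ler0n R 2)) -!powRrM.
    by congr (_ `^ _); rewrite natrM mulrAC hc.
  by apply: ge0_ler_powR => //; rewrite ?nnegrE // ler_nat.
have p0 : 0 < n%:R `^ c :> R by rewrite powR_gt0.
rewrite -[leRHS]mul1r ler_pdivlMr //.
apply: (@le_trans _ _ (45 * (3 / 5) ^+ q * (11 / 10) ^+ q.+1)).
  rewrite ler_wpM2l ?mulr_ge0 ?exprn_ge0 ?divr_ge0 //; apply: le_trans hz _.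
  by rewrite lerXn2r ?nnegrE ?(ltW z0) ?divr_ge0.
have -> : 45 * (3 / 5) ^+ q * (11 / 10) ^+ q.+1 = 45 * (11 / 10) * (3 / 5 * (11 / 10)) ^+ q :> R.
  by rewrite [(3 / 5 * _) ^+ q]exprMn [_ ^+ q.+1]exprS; ring.
have h : (3 / 5 * (11 / 10)) ^+ q <= (33 / 50) ^+ 10 :> R.
  have -> : 3 / 5 * (11 / 10) = 33 / 50 :> R by lra.
  by apply: ler_wiXn2l => //; lra.
have : (33 / 50) ^+ 10 <= 1 / 60 :> R by lra.
move: h; set y := _ ^+ q; set w := _ ^+ 10; lra.
Qed.

End Asymptotics.

Theorem theorem1p2 (R : realType) :
  exists c : R, 0 < c /\
  forall eps : R, 0 < eps ->
  exists N : nat, forall n : nat, (N <= n)%N -> (1 <= n)%N ->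
  forall (d : measure_display) (T : measurableType d) (P : probability T R)
    (X : 'I_n -> 'I_n -> {RV P >-> R}),
    mutually_independent (fun ij : 'I_n * 'I_n => X ij.1 ij.2) ->
    (forall i j : 'I_n, random_sign (X i j)) ->
    ((1 - n%:R `^ (- c))%:E <=
      P [set w : T | n%:R `^ ((2^-1 - eps) * n%:R) <=
                     `|permanent (random_mx X w)|]%R)%E.
Proof.
pose c : R := 40^-1 * 10^-1.
have c0 : 0 < c by rewrite mulr_gt0 ?invr_gt0.
have hc : 40 * c = 10^-1 by rewrite mulrA divff ?mul1r // pnatr_eq0.
exists c; split=> //; clearbody c.
move=> eps eps0; have [k [N [k2 hN]]] := threshold_eventually eps0.
have [q0 q0_ge10] : exists q0, (10 <= q0)%N by exists 10%N.
(* [81 k^2 <= n] and [q^2 <= n] give [(9 q k)^2 <= n^2]; the last term forces [q >= 10]. *)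
exists (maxn N (maxn (81 * k ^ 2) (2 ^ (40 * q0)))) => n.
rewrite !geq_max => /and3P[nN nk n40] n0 d T P X indepX signX.
(* So [n] lies between [2^(40 q)] and [2^(40 (q + 1))]. *)
pose q := (trunc_log 2 n %/ 40)%N.
have q10 : (10 <= q)%N.
  apply: leq_trans q0_ge10 _.
  by rewrite /q leq_divRL // mulnC -(@trunc_expnK 2 (40 * q0)) // leq_trunc_log.
have qlog : (40 * q <= trunc_log 2 n)%N by rewrite mulnC leq_trunc_div.
have n_ge : (2 ^ (40 * q) <= n)%N.
  by have := trunc_logP (isT : (1 < 2)%N) n0; apply: leq_trans; rewrite leq_exp2l.
have n_le : (n <= 2 ^ (40 * q.+1))%N.
  apply: ltnW; apply: leq_trans (trunc_log_ltn n (isT : (1 < 2)%N)) _.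
  by rewrite leq_exp2l // mulnC ltn_ceil.
have k0 : (0 < k)%N by apply: leq_trans k2.
have q9 : (9 * q <= n %/ k)%N.
  rewrite leq_divRL // -leq_sqr.
  have -> : ((9 * q * k) ^ 2 = 81 * k ^ 2 * (q ^ 2))%N by rewrite !expnMn mulnAC.
  rewrite (expnD n 1 1) expn1; apply: leq_mul nk _.
  apply: leq_trans n_ge; apply: (@leq_trans ((2 ^ q) ^ 2)).
    by rewrite leq_sqr ltnW // ltn_expl.
  by rewrite -expnM leq_exp2l // mulnC leq_mul2r orbT.
have [_ tM hL] := hN n q nN q9.
have q_gt0 : (0 < q)%N by apply: leq_trans q10.
have L0 : 0 < n%:R `^ ((2^-1 - eps) * n%:R) :> R by rewrite powR_gt0 // ltr0n.
apply: le_trans (prob_permanent_ge indepX signX _); rewrite lee_fin lerD2l lerN2.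
apply: le_trans (permanent_state_bound_num q_gt0 k2 n_ge tM q9 L0 hL) _.
exact: failure_le_powR (ltW c0) hc q10 n0 n_le.
Qed.
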